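(* The free associative algebra $\mathcal{H}^{\rho,\mathrm{nc}}_Y=\mathbb{Q}\langle\bar Y\rangle\cong\mathbb{Q}\langle Y\rangle/(\mathsf{o}-1)$ is a graded and connected Hopf algebra, with grading given by the order of trees. The coproduct is the algebra morphism $\Delta^{\rho}_Y$ defined on any generator $u\in\bar Y$ by $$\Delta^{\rho}_Y(u)=1\otimes u+\sum_{\substack{t\in\bar Y,\ s_1,\dots,s_{|t|+1}\in Y\\ u=\mu_t(s_1/\mathsf{v},\dots,s_{|t|}/\mathsf{v})/s_{|t|+1}}} t\otimes s_1\cdots s_{|t|}\,s_{|t|+1},$$ and the counit is the algebra morphism with $\varepsilon(u)=0$ for any $u\in\bar Y$.
   Context: A tree means a planar binary rooted tree; its order $|t|$ is the number of its internal (trivalent) vertices. $Y_n$ is the set of trees of order $n$, $Y=\bigcup_{n\ge 0}Y_n$, $\bar Y=\bigcup_{n\ge 1}Y_n$. The root tree (order $0$) is denoted $\mathsf{o}$, the vertex tree (the unique tree of order $1$) is denoted $\mathsf{v}$. For trees $t,s$: $t/s$ (''over'') is obtained by grafting the root of $t$ on the left-most leaf of $s$; $t\backslash s$ (''under'') is obtained by grafting the root of $s$ on the right-most leaf of $t$. Both are associative with unit $\mathsf{o}$, and $(a/b)\backslash c=a/(b\backslash c)$ whenever $b\neq\mathsf{o}$. Every $t\in\bar Y$ can be written uniquely as $t=t^l/\mathsf{v}\backslash t^r$ with $t^l,t^r\in Y$. For $t\in\bar Y$ the $t$-product $\mu_t:\bar Y^{|t|}\to\bar Y$ is obtained by writing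 $t$ as a monomial in $\mathsf{v}$ for the over and under products and replacing the $i$-th copy of $\mathsf{v}$ (from left to right) by $s_i$; equivalently, recursively, with $n=|t|$ and $k=|t^l|$, $$\mu_t(s_1,\dots,s_n)=\mu_{t^l}(s_1,\dots,s_k)/s_{k+1}\backslash\mu_{t^r}(s_{k+2},\dots,s_n),\qquad \mu_{\mathsf{o}}()=\mathsf{o}.$$ In the right tensor factors of the coproduct, $s_1\cdots s_{|t|+1}$ is the free (concatenation) product, with $\mathsf{o}$ identified with the unit $1$. *)

(* Defs.v *)
From HB Require Import structures.
From mathcomp Require Import all_boot all_order all_algebra finmap.
From mathcomp Require Import boolp classical_sets cardinality fsbigop.
From mathcomp.multinomials Require Import monalg.

Set Implicit Arguments.
Unset Strict Implicit.
Unset Printing Implicit Defensive.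

Import GRing.Theory.
Local Open Scope ring_scope.

Inductive tree := Leaf | Node of tree & tree.

Fixpoint tree_encode (t : tree) : GenTree.tree unit :=
  if t is Node l r then GenTree.Node 0 [:: tree_encode l; tree_encode r]
  else GenTree.Leaf tt.

Fixpoint tree_decode (g : GenTree.tree unit) : option tree :=
  match g with
  | GenTree.Leaf _ => Some Leaf
  | GenTree.Node _ [:: a; b] =>
      if (tree_decode a, tree_decode b) is (Some l, Some r)
      then Some (Node l r) else None
  | _ => None
  end.

Lemma tree_encodeK : pcancel tree_encode tree_decode.
Proof. by elim=> //= l -> r ->. Qed.

HB.instance Definition _ := Countable.copy tree (pcan_type tree_encodeK).

Definition vertex : tree := Node Leaf Leaf.

Fixpoint order (t : tree) : nat :=
  if t is Node l r then (order l + order r)%N.+1 else 0%N.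

(* [over t s] is t / s and [under t s] is t \ s. *)
Fixpoint over (t s : tree) : tree :=
  if s is Node l r then Node (over t l) r else t.

Fixpoint under (t s : tree) : tree :=
  if t is Node l r then Node l (under r s) else s.

Lemma overA : associative over.
Proof. by move=> a b; elim=> //= l -> r _. Qed.

Lemma underA : associative under.
Proof. by elim=> //= l _ r IH b c; rewrite IH. Qed.

Lemma under_overA a b c : b != Leaf -> under (over a b) c = over a (under b c).
Proof. by case: b. Qed.

Lemma over0t : left_id Leaf over.
Proof. by elim=> //= l -> r _. Qed.

Lemma undert0 : right_id Leaf under.
Proof. by elim=> //= l _ r ->. Qed.

(* The decomposition t = t^l / v \ t^r: t^l and t^r are the two subtrees. *)
Lemma NodeE l r : Node l r = under (over l vertex) r.
Proof. by []. Qed.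

(* The t-product; meaningful when [size s = order t] and the entries of [s]
   are not the root tree. *)
Fixpoint mu (t : tree) (s : seq tree) : tree :=
  if t is Node l r then
    under (over (mu l (take (order l) s)) (nth Leaf s (order l)))
          (mu r (drop (order l).+1 s))
  else Leaf.

Definition Ybar := {t : tree | t != Leaf}.

(* [{malg K[I]}] is the K-module with basis I.  The tensor product of
   [{malg K[I]}] and [{malg K[J]}] is realised as the K-module with basis I * J;
   [tliftP] and [tlift_uniq] state its universal property. *)

Section Tensor.
Context {K : fieldType}.

Definition mlift {I : choiceType} {W : lmodType K} (h : I -> W)
    (x : {malg K[I]}) : W :=
  \sum_(i <- msupp x) x@_i *: h i.

Definition tens {I J : choiceType} (a : {malg K[I]}) (b : {malg K[J]}) :
    {malg K[(I * J)%type]} :=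
  \sum_(i <- msupp a) \sum_(j <- msupp b) << a@_i * b@_j *g (i, j) >>.

(* The linear map on the tensor product induced by a bilinear map. *)
Definition tlift {I J : choiceType} {W : lmodType K}
    (f : {malg K[I]} -> {malg K[J]} -> W) : {malg K[(I * J)%type]} -> W :=
  mlift (fun p => f << p.1 >> << p.2 >>).

Definition tmap {I J I' J' : choiceType}
    (f : {malg K[I]} -> {malg K[I']}) (g : {malg K[J]} -> {malg K[J']}) :
    {malg K[(I * J)%type]} -> {malg K[(I' * J')%type]} :=
  tlift (fun a b => tens (f a) (g b)).

Definition tassoc {I J L : choiceType} :
    {malg K[(I * J * L)%type]} -> {malg K[(I * (J * L))%type]} :=
  tlift (fun x c => tlift (fun a b => tens a (tens b c)) x).

Section MLift.
Context {I : choiceType} {W : lmodType K}.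

Lemma mliftEw (h : I -> W) (d : {fset I}) x : (msupp x `<=` d)%fset ->
  mlift h x = \sum_(i <- d) x@_i *: h i.
Proof.
move=> le; rewrite /mlift (big_fset_incl _ le) //= => i _ /mcoeff_outdom ->.
by rewrite scale0r.
Qed.

Lemma mlift_is_linear (h : I -> W) : linear (mlift h).
Proof.
move=> k x y; pose d := (msupp x `|` msupp y `|` msupp (k *: x + y))%fset.
rewrite (@mliftEw h d x) ?(@mliftEw h d y) ?(@mliftEw h d (k *: x + y)).
- rewrite scaler_sumr -big_split; apply: eq_bigr => i _ /=.
  by rewrite mcoeffD mcoeffZ scalerDl scalerA.
- by apply/fsubsetP => i; rewrite !inE => ->; rewrite !orbT.
- by apply/fsubsetP => i; rewrite !inE => ->; rewrite !orbT.
- by apply/fsubsetP => i; rewrite !inE => ->.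
Qed.

HB.instance Definition _ (h : I -> W) :=
  GRing.isLinear.Build K {malg K[I]} W *:%R (mlift h) (mlift_is_linear h).

Lemma mliftU (h : I -> W) i : mlift h << i >> = h i.
Proof. by rewrite (mliftEw h msuppU_le) big_seq_fset1 mcoeffUU scale1r. Qed.

Lemma malgUZ (k : K) (i : I) : << k *g i >> = k *: << i >>.
Proof. by apply/malgP => j; rewrite mcoeffZ !mcoeffU mulrnAr mulr1. Qed.

Lemma malg_basis (x : {malg K[I]}) :
  x = \sum_(i <- msupp x) x@_i *: << i >>.
Proof. by rewrite {1}[x]monalgE; apply: eq_bigr => i _; rewrite malgUZ. Qed.

Lemma mlift_uniq (h : I -> W) (g : {linear {malg K[I]} -> W}) :
  (forall i, g << i >> = h i) -> g =1 mlift h.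
Proof.
move=> gh x; rewrite {1}[x]malg_basis linear_sum.
by apply: eq_bigr => i _; rewrite linearZ /= gh.
Qed.

End MLift.

Section TLift.
Context {I J : choiceType} {W : lmodType K}.

Lemma tensU (i : I) (j : J) : tens << i >> << j >> = << (i, j) >> :> {malg K[_]}.
Proof.
by rewrite /tens !msuppU !oner_eq0 !big_seq_fset1 !mcoeffUU mulr1.
Qed.

Lemma tliftP (f : {malg K[I]} -> {malg K[J]} -> W) :
  (forall b, linear (f^~ b)) -> (forall a, linear (f a)) ->
  forall a b, tlift f (tens a b) = f a b.
Proof.
move=> fl fr a b.
pose F b : {linear {malg K[I]} -> W} :=
  HB.pack (f^~ b) (GRing.isLinear.Build K {malg K[I]} W *:%R (f^~ b) (fl b)).
pose G a : {linear {malg K[J]} -> W} :=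
  HB.pack (f a) (GRing.isLinear.Build K {malg K[J]} W *:%R (f a) (fr a)).
have fE x y : f x y = \sum_(i <- msupp x) x@_i *: f << i >> y.
  rewrite -[LHS]/(F y x) [X in F y X]malg_basis linear_sum.
  by apply: eq_bigr => i _; rewrite linearZ.
have gE x y : f x y = \sum_(j <- msupp y) y@_j *: f x << j >>.
  rewrite -[LHS]/(G x y) [X in G x X]malg_basis linear_sum.
  by apply: eq_bigr => i _; rewrite linearZ.
rewrite /tlift /tens linear_sum fE; apply: eq_bigr => i _.
rewrite linear_sum gE scaler_sumr; apply: eq_bigr => j _.
by rewrite malgUZ linearZ /= mliftU scalerA.
Qed.

Lemma tlift_uniq (f : {malg K[I]} -> {malg K[J]} -> W)
    (g : {linear {malg K[(I * J)%type]} -> W}) :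
  (forall a b, g (tens a b) = f a b) -> g =1 tlift f.
Proof. by move=> gf; apply: mlift_uniq => -[i j]; rewrite -tensU gf. Qed.

End TLift.
End Tensor.

(* Componentwise product of monoids: it makes the tensor product of two monoid
   algebras an algebra, with (a (x) b)(a' (x) b') = aa' (x) bb' ([tensM]). *)
Section ProdMonom.
Context {M N : monomType}.
Local Open Scope monom_scope.

Definition pmul (p q : M * N) := (mmul p.1 q.1, mmul p.2 q.2).
Definition pone : M * N := (mone, mone).

Lemma pmulA : associative pmul.
Proof. by move=> a b c; rewrite /pmul /= !mulmA. Qed.

Lemma pmul1 : left_id pone pmul.
Proof. by case=> a b; rewrite /pmul /= !mul1m. Qed.

Lemma pmulr1 : right_id pone pmul.
Proof. by case=> a b; rewrite /pmul /= !mulm1. Qed.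

Lemma pmul_eq1 p q : pmul p q = pone -> p = pone /\ q = pone.
Proof.
by case: p q => [a b] [c d] [] /= /unitm[-> ->] /unitm[-> ->].
Qed.

HB.instance Definition _ :=
  Choice_isMonomialDef.Build (M * N)%type pmulA pmul1 pmulr1 pmul_eq1.
End ProdMonom.

Section Hopf.
Context {K : fieldType} {M : monomType}.
Local Notation A := {malg K[M]}.
Local Notation A2 := {malg K[(M * M)%type]}.

Definition algebra_morphism (B C : lalgType K) (f : B -> C) : Prop :=
  linear f /\ monoid_morphism f.

Record bialgebra (D : A -> A2) (e : A -> K) : Prop := Bialgebra {
  comul_morphism : algebra_morphism D;
  counit_morphism : @algebra_morphism A K^o e;
  comul_coassoc : forall a, tassoc (tmap D id (D a)) = tmap id D (D a);
  comul_counitl : forall a, tlift (fun b c : A => e b *: c) (D a) = a;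
  comul_counitr : forall a, tlift (fun b c : A => e c *: b) (D a) = a
}.

Record antipode (D : A -> A2) (e : A -> K) (S : A -> A) : Prop := Antipode {
  antipode_linear : linear S;
  antipodel : forall a, tlift *%R (tmap S id (D a)) = (e a)%:A;
  antipoder : forall a, tlift *%R (tmap id S (D a)) = (e a)%:A
}.

(* A is the internal direct sum of the submodules [G n], and is graded as an
   algebra. *)
Record algebra_grading (G : nat -> A -> Prop) : Prop := AlgebraGrading {
  grading0 : forall n, G n 0;
  grading_linear : forall n k a b, G n a -> G n b -> G n (k *: a + b);
  grading_span : forall a, exists N (f : nat -> A),
    (forall n, G n (f n)) /\ a = \sum_(n < N) f n;
  grading_direct : forall N (f : nat -> A), (forall n, G n (f n)) ->
    \sum_(n < N) f n = 0 -> forall n, (n < N)%N -> f n = 0;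
  grading1 : G 0%N 1;
  gradingM : forall i j a b, G i a -> G j b -> G (i + j)%N (a * b)
}.

(* The degree n part of the tensor product: the span of the
   [G i] (x) [G j] with i + j = n. *)
Definition tens_grading (G : nat -> A -> Prop) (n : nat) (x : A2) : Prop :=
  exists s : seq (A * A),
    (forall p, p \in s -> exists i j, [/\ (i + j)%N = n, G i p.1 & G j p.2]) /\
    x = \sum_(p <- s) tens p.1 p.2.

Record graded_connected_hopf (G : nat -> A -> Prop) (D : A -> A2) (e : A -> K) :
    Prop := GradedConnectedHopf {
  hopf_bialgebra : bialgebra D e;
  hopf_grading : algebra_grading G;
  hopf_comul_graded : forall n a, G n a -> tens_grading G n (D a);
  hopf_counit_graded : forall n a, G n a -> n != 0%N -> e a = 0;
  hopf_antipode : exists S : A -> A,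
    antipode D e S /\ forall n a, G n a -> G n (S a);
  hopf_connected : forall a, G 0%N a <-> exists c : K, a = c%:A
}.

End Hopf.

Section TensM.
Context {K : fieldType} {M N : monomType}.

Lemma tensM (a a' : {malg K[M]}) (b b' : {malg K[N]}) :
  tens a b * tens a' b' = tens (a * a') (b * b').
Proof.
have tensE (c : {malg K[M]}) (d : {malg K[N]}) p :
    (tens c d)@_p = c@_p.1 * d@_p.2.
  rewrite /tens raddf_sum /= [in RHS](monalgE c) raddf_sum mulr_suml.
  apply: eq_bigr => i _; rewrite raddf_sum /= [in RHS](monalgE d) raddf_sum mulr_sumr.
  apply: eq_bigr => j _; rewrite !mcoeffU.
  by rewrite /= !mcoeffU mulrnAl mulrnAr -mulrnA mulnb andbC; case: (p).
apply/malgP => -[p q]; rewrite tensE /=.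
rewrite {1}/tens mulr_suml raddf_sum /= (mcoeffMl a) (mcoeffMl b) mulr_suml.
apply: eq_bigr => i _.
have -> : (\sum_(j <- msupp b) << a@_i * b@_j *g (i, j) >>) * tens a' b' =
  \sum_(j <- msupp b) \sum_(i' <- msupp a') \sum_(j' <- msupp b')
    << (a@_i * b@_j) * (a'@_i' * b'@_j') *g (mmul i i', mmul j j') >>.
  rewrite mulr_suml; apply: eq_bigr => j _.
  rewrite mulr_sumr; apply: eq_bigr => i' _.
  rewrite mulr_sumr; apply: eq_bigr => j' _.
  by rewrite malgM_def fgmulUU.
rewrite exchange_big raddf_sum mulr_suml; apply: eq_bigr => i' _.
rewrite raddf_sum mulr_sumr; apply: eq_bigr => j _ /=.
rewrite raddf_sum mulr_sumr; apply: eq_bigr => j' _ /=.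
rewrite mcoeffU mulrnAl mulrnAr -mulrnA mulnb mulrACA xpair_eqE andbC.
by [].
Qed.
End TensM.

Section IdealQuotient.
Context {K : fieldType} {A : lalgType K} (c : A).
Local Open Scope quotient_scope.

Definition ideal_gen : {pred A} := fun a =>
  `[< exists s : seq (A * A), a = \sum_(p <- s) p.1 * c * p.2 >].

Lemma ideal_genP a :
  reflect (exists s : seq (A * A), a = \sum_(p <- s) p.1 * c * p.2)
          (a \in ideal_gen).
Proof. exact: asboolP. Qed.

Lemma ideal_gen_zmod : zmod_closed ideal_gen.
Proof.
split; first by apply/ideal_genP; exists [::]; rewrite big_nil.
move=> _ _ /ideal_genP[s ->] /ideal_genP[s' ->]; apply/ideal_genP.
exists (s ++ [seq (- p.1, p.2) | p <- s']); rewrite big_cat big_map /= -sumrN.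
by congr (_ + _); apply: eq_bigr => p _; rewrite !mulNr.
Qed.

HB.instance Definition _ := GRing.isZmodClosed.Build A ideal_gen ideal_gen_zmod.

Lemma ideal_genMl a x : x \in ideal_gen -> a * x \in ideal_gen.
Proof.
move=> /ideal_genP[s ->]; apply/ideal_genP; exists [seq (a * p.1, p.2) | p <- s].
by rewrite big_map mulr_sumr; apply: eq_bigr => p _; rewrite !mulrA.
Qed.

Lemma ideal_genMr a x : x \in ideal_gen -> x * a \in ideal_gen.
Proof.
move=> /ideal_genP[s ->]; apply/ideal_genP; exists [seq (p.1, p.2 * a) | p <- s].
by rewrite big_map mulr_suml; apply: eq_bigr => p _; rewrite !mulrA.
Qed.

Lemma ideal_genZ k x : x \in ideal_gen -> k *: x \in ideal_gen.
Proof. by move=> xI; rewrite -[x]mul1r scalerAl ideal_genMl. Qed.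

Definition ideal_quotient : Type := Quotient.quot ideal_gen.
Local Notation Q := ideal_quotient.

HB.instance Definition _ := GRing.Zmodule.on Q.
HB.instance Definition _ := EqQuotient.on Q.

Definition qpi (a : A) : Q := \pi_Q a.

Definition qone : Q := qpi 1.
Definition qmul (x y : Q) : Q := qpi (repr x * repr y).
Definition qscale (k : K) (x : Q) : Q := qpi (k *: repr x).

Lemma qpiP a b : reflect (qpi a = qpi b) (a - b \in ideal_gen).
Proof. by rewrite Quotient.idealrBE; exact: eqP. Qed.

Lemma qpiB : {morph qpi : a b / a - b}.
Proof. by move=> a b; rewrite /qpi !piE. Qed.

Lemma qpiD : {morph qpi : a b / a + b}.
Proof. by move=> a b; rewrite /qpi !piE. Qed.

Lemma qreprK x : qpi (repr x) = x. Proof. exact: reprK. Qed.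

Lemma repr_qpi a : repr (qpi a) - a \in ideal_gen.
Proof. by apply/qpiP; rewrite qreprK. Qed.

Lemma qpiM : {morph qpi : a b / a * b >-> qmul a b}.
Proof.
move=> a b; apply/esym/qpiP.
rewrite -(subrKA (a * repr (qpi b))) -mulrBl -mulrBr rpredD //.
  exact/ideal_genMr/repr_qpi.
exact/ideal_genMl/repr_qpi.
Qed.

Lemma qpiZ k a : qpi (k *: a) = qscale k (qpi a).
Proof. by apply/esym/qpiP; rewrite -scalerBr; exact/ideal_genZ/repr_qpi. Qed.

Lemma qmulA : associative qmul.
Proof.
by move=> x y z; rewrite -[x]qreprK -[y]qreprK -[z]qreprK -!qpiM mulrA.
Qed.

Lemma qmul1 : left_id qone qmul.
Proof. by move=> x; rewrite -[x]qreprK -qpiM mul1r. Qed.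

Lemma qmulr1 : right_id qone qmul.
Proof. by move=> x; rewrite -[x]qreprK -qpiM mulr1. Qed.

Lemma qmulDl : left_distributive qmul +%R.
Proof.
move=> x y z; rewrite -[x]qreprK -[y]qreprK -[z]qreprK.
by rewrite -qpiD -!qpiM -qpiD mulrDl.
Qed.

Lemma qmulDr : right_distributive qmul +%R.
Proof.
move=> x y z; rewrite -[x]qreprK -[y]qreprK -[z]qreprK.
by rewrite -qpiD -!qpiM -qpiD mulrDr.
Qed.

HB.instance Definition _ :=
  GRing.Zmodule_isPzRing.Build Q qmulA qmul1 qmulr1 qmulDl qmulDr.

Lemma qscaleA k l x : qscale k (qscale l x) = qscale (k * l) x.
Proof. by rewrite -[x]qreprK -!qpiZ scalerA. Qed.

Lemma qscale1 : left_id 1 qscale.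
Proof. by move=> x; rewrite -[x]qreprK -qpiZ scale1r. Qed.

Lemma qscaleDr : right_distributive qscale +%R.
Proof.
move=> k x y; rewrite -[x]qreprK -[y]qreprK.
by rewrite -qpiD -!qpiZ -qpiD scalerDr.
Qed.

Lemma qscaleDl x : {morph qscale^~ x : k l / k + l}.
Proof. by move=> k l; rewrite -[x]qreprK -!qpiZ -qpiD scalerDl. Qed.

HB.instance Definition _ :=
  GRing.Zmodule_isLmodule.Build K Q qscaleA qscale1 qscaleDr qscaleDl.

End IdealQuotient.

Notation free_algebra I := {malg rat[{fmonom I}]}.

Definition gen {I : choiceType} (i : I) : free_algebra I := << fmu i >>.

(* The algebra morphism with prescribed values on the generators. *)
Definition free_lift {I : choiceType} {A : lalgType rat} (f : I -> A) :
    free_algebra I -> A :=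
  mlift (fun w : {fmonom I} => \prod_(i <- (w : seq I)) f i).

Lemma free_lift_gen {I : choiceType} {A : lalgType rat} (f : I -> A) i :
  free_lift f (gen i) = f i.
Proof. by rewrite /free_lift /gen mliftU fmuE big_seq1. Qed.

Notation HY := (free_algebra Ybar).
Notation HY2 := {malg rat[({fmonom Ybar} * {fmonom Ybar})%type]}.

(* The root tree is identified with the unit. *)
Definition ygen (t : tree) : HY := oapp (@gen Ybar) 1 (insub t).

(* The pairs of a tree t of positive order and a sequence s_1, ..., s_(|t|+1)
   of trees with u = mu_t (s_1 / v, ..., s_|t| / v) / s_(|t|+1). *)
Definition coproduct_index (u : tree) : set (Ybar * seq tree) :=
  [set p | size p.2 = (order (val p.1)).+1 /\
    u = over (mu (val p.1)
               [seq over x vertex | x <- take (order (val p.1)) p.2])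
             (last Leaf p.2)]%classic.

Definition coproduct_gen (u : Ybar) : HY2 :=
  tens 1 (gen u) +
  \sum_(p \in coproduct_index (val u))
    tens (gen p.1) (\prod_(x <- p.2) ygen x).

Definition coproduct : HY -> HY2 := free_lift coproduct_gen.

Definition counit : HY -> rat := free_lift (fun _ : Ybar => 0 : rat^o).

Definition word_order (w : {fmonom Ybar}) : nat :=
  (\sum_(u <- (w : seq Ybar)) order (val u))%N.

(* The span of the words of order n. *)
Definition homogeneous (n : nat) (a : HY) : Prop :=
  forall w, w \in msupp a -> word_order w = n.

(* The sum defining [coproduct_gen] is finite (a finitely supported sum over an
   infinite support would be 0 by convention). *)

Lemma order_over a b : order (over a b) = (order a + order b)%N.
Proof. by elim: b => [|l IHl r _] /=; rewrite ?addn0 // IHl addnS addnA. Qed.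

Lemma order_under a b : order (under a b) = (order a + order b)%N.
Proof. by elim: a => [|l _ r IHr] //=; rewrite IHr addSn addnA. Qed.

Lemma order_mu t s : size s = order t ->
  order (mu t s) = (\sum_(x <- s) order x)%N.
Proof.
elim: t s => [|l IHl r IHr] /= s sz.
  by rewrite (size0nil sz) big_nil.
have ltls : (order l < size s)%N by rewrite sz ltnS leq_addr.
rewrite order_under order_over IHl ?size_takel ?(ltnW ltls) //.
rewrite IHr ?size_drop ?sz ?subSS ?addKn //.
rewrite -{4}[s](cat_take_drop (order l)) (drop_nth Leaf ltls).
by rewrite big_cat big_cons /= addnA.
Qed.

Lemma finite_trees n : exists L : seq tree, forall t, (order t <= n)%N -> t \in L.
Proof.
elim: n => [|n [L HL]].
  by exists [:: Leaf] => -[].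
exists (Leaf :: [seq Node l r | l <- L, r <- L]) => -[|l r] //=.
rewrite ltnS inE => le; apply/orP; right; apply: allpairs_f; apply: HL.
  exact: leq_trans (leq_addr _ _) le.
exact: leq_trans (leq_addl _ _) le.
Qed.

Lemma finite_words (T : eqType) (L : seq T) n : exists LL : seq (seq T),
  forall s, (size s <= n)%N -> {subset s <= L} -> s \in LL.
Proof.
elim: n => [|n [LL HLL]]; first by exists [:: [::]] => -[].
exists ([::] :: [seq x :: s | x <- L, s <- LL]) => -[|x s] //= lt sub.
rewrite inE; apply/orP; right; apply: allpairs_f; first exact/sub/mem_head.
by apply: HLL => // y ys; apply: sub; rewrite inE ys orbT.
Qed.

Lemma coproduct_index_finite u : finite_set (coproduct_index u).
Proof.
have [L HL] := finite_trees (order u).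
have [LL HLL] := finite_words L (order u).+1.
apply: (@sub_finite_set _ _
  [set` [seq (t, s) | t <- pmap insub L : seq Ybar, s <- LL]]%classic);
  last exact: finite_seq.
move=> [t s] /= [sz uE].
have sE : s = rcons (take (order (val t)) s) (last Leaf s).
  case/lastP: s sz {uE} => // s x; rewrite size_rcons => -[sz].
  by rewrite last_rcons -cats1 take_size_cat ?cats1.
have ou : order u = (order (val t) + \sum_(x <- s) order x)%N.
  rewrite uE order_over order_mu ?size_map ?size_takel ?sz ?leqnSn //.
  rewrite big_map [in RHS]sE -cats1 big_cat big_seq1 /= addnA; congr (_ + _)%N.
  under eq_bigr do rewrite /= addn0 -addn1.
  by rewrite big_split /= sum1_size size_takel ?sz ?leqnSn // addnC.
apply: allpairs_f.
  by rewrite mem_pmap_sub; apply: HL; rewrite ou leq_addr.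
apply: HLL; first by rewrite sz ltnS ou leq_addr.
move=> x xs; apply: HL; rewrite ou (big_rem x) //=.
by rewrite addnCA leq_addr.
Qed.

(* Main.v *)
Require Import Defs.
From HB Require Import structures.
From mathcomp Require Import all_boot all_order all_algebra finmap.
From mathcomp Require Import boolp classical_sets cardinality fsbigop.
From mathcomp.multinomials Require Import monalg.

(* Let P be the sum of u (x) [u] over all trees u, with noncommuting
   coefficients [u], and put M_t = mu_t (P / v, ..., P / v) and F_t = M_t / P.
   With f(t, u) the coefficient of u in F_t, the coproduct reads
   Delta [u] = sum_t [t] (x) f(t, u), so coassociativity amounts to
   Delta f(w, u) = sum_t f(w, t) (x) f(t, u).  This follows by induction on w
   from M_(t^l / v \ t^r) = (F_(t^l) / v) \ M_(t^r) and F_(t / t') = M_t / F_t'.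
   The matrix f is unitriangular for the order of trees, hence invertible, and
   its inverse gives the antipode. *)

(** The tree o is allowed as an index: F_o = P, so the term 1 (x) u of the coproduct is the summand
    t = o, and f becomes a square matrix. Applying Delta to the coefficients of P gives the sum of
    the [t] (x) F_t, so on the right-hand side every tree t is replaced by F_t. The two identities
    say that the F's substituted into a monomial recombine into M_t and F_t, which is why Delta f(w,
    u) is a matrix product. Both identities keep the letters in planar order, so the argument never
    exchanges two coefficients. Sums over all trees are represented by sums over [trees n] for an
    arbitrary n above the order of u; the terms outside vanish by triangularity, and the support
    hypotheses of the summation lemmas keep track of this. The recursion defining S on generators is
    the left antipode law itself. It says nothing direct about the right law, which involves S of
    the words in f(t, u); this is the reason for the detour through an inverse matrix. *)

Set Implicit Arguments.
Unset Strict Implicit.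
Unset Printing Implicit Defensive.

(* Defs is imported again because [order] is shadowed by [fingraph]. *)
Import GRing.Theory Defs.
Local Open Scope ring_scope.

(** * Linear maps on monoid algebras *)

Section MalgExt.
Context {K : fieldType}.

Lemma malg_ind {I : choiceType} (P : {malg K[I]} -> Prop) :
  P 0 -> (forall i, P << i >>) ->
  (forall k a b, P a -> P b -> P (k *: a + b)) -> forall a, P a.
Proof.
move=> P0 PU PL a; rewrite [a]malg_basis.
by elim/big_rec: _ => // i x _; apply: PL.
Qed.

Lemma linear_fun0 {V W : lmodType K} {f : V -> W} : linear f -> f 0 = 0.
Proof. by move=> fl; rewrite -[0 in LHS](subrr 0) -scaleN1r addrC fl scaleN1r addNr. Qed.

Lemma linear_funD {V W : lmodType K} {f : V -> W} :
  linear f -> {morph f : x y / x + y}.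
Proof. by move=> fl x y; rewrite -[x]scale1r fl !scale1r. Qed.

Lemma linear_funZ {V W : lmodType K} {f : V -> W} :
  linear f -> forall k, {morph f : x / k *: x}.
Proof. by move=> fl k x; rewrite -[k *: x]addr0 fl linear_fun0 ?addr0. Qed.

Lemma linear_funB {V W : lmodType K} {f : V -> W} :
  linear f -> {morph f : x y / x - y}.
Proof.
by move=> fl x y; rewrite (linear_funD fl) -scaleN1r (linear_funZ fl) scaleN1r.
Qed.

Lemma linear_fun_sum {V W : lmodType K} {f : V -> W} : linear f ->
  forall (T : Type) (r : seq T) (P : pred T) (F : T -> V),
  f (\sum_(i <- r | P i) F i) = \sum_(i <- r | P i) f (F i).
Proof.
by move=> fl T r P F; apply: big_morph; [exact: linear_funD | exact: linear_fun0].
Qed.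

Lemma malg_ext {I : choiceType} {W : lmodType K} (f g : {malg K[I]} -> W) :
  linear f -> linear g -> (forall i, f << i >> = g << i >>) -> f =1 g.
Proof.
move=> fl gl fg; apply: malg_ind => // [|k a b fa fb].
  by rewrite !linear_fun0.
by rewrite fl gl fa fb.
Qed.

Lemma malg_ext2 {I J : choiceType} {W : lmodType K}
    (f g : {malg K[I]} -> {malg K[J]} -> W) :
  (forall b, linear (f^~ b)) -> (forall a, linear (f a)) ->
  (forall b, linear (g^~ b)) -> (forall a, linear (g a)) ->
  (forall i j, f << i >> << j >> = g << i >> << j >>) ->
  forall a b, f a b = g a b.
Proof.
move=> fl fr gl gr fg a b; move: a; apply: malg_ext => // i.
by move: b; apply: malg_ext.
Qed.

Lemma linear_comp {U V W : lmodType K} (f : V -> W) (g : U -> V) :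
  linear f -> linear g -> linear (f \o g).
Proof. by move=> fl gl k x y /=; rewrite gl fl. Qed.

Lemma linear_eq_comb {V W : lmodType K} (f g : V -> W) :
  linear f -> linear g -> forall k a b,
  f a = g a -> f b = g b -> f (k *: a + b) = g (k *: a + b).
Proof. by move=> fl gl k a b fa fb; rewrite fl gl fa fb. Qed.

Lemma mlift_linear {I : choiceType} {W : lmodType K} (h : I -> W) :
  linear (mlift h).
Proof. exact: linearP. Qed.

Lemma tlift_linear {I J : choiceType} {W : lmodType K}
  (f : {malg K[I]} -> {malg K[J]} -> W) : linear (tlift f).
Proof. exact: linearP. Qed.

Lemma tlift_linear_param {I J : choiceType} {V W : lmodType K}
    (f : V -> {malg K[I]} -> {malg K[J]} -> W) :
  (forall a b, linear (fun z => f z a b)) ->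
  forall d, linear (fun z => tlift (f z) d).
Proof.
move=> fl d k x y; rewrite /tlift /mlift scaler_sumr -big_split.
apply: eq_bigr => p _ /=; rewrite fl scalerDr !scalerA.
by rewrite [d@__ * k]mulrC.
Qed.

Lemma tliftU {I J : choiceType} {W : lmodType K}
  (f : {malg K[I]} -> {malg K[J]} -> W) i j :
  tlift f << (i, j) >> = f << i >> << j >>.
Proof. exact: mliftU. Qed.

Lemma mcoeff_tens {I J : choiceType} (a : {malg K[I]}) (b : {malg K[J]}) p :
  (tens a b)@_p = a@_p.1 * b@_p.2.
Proof.
rewrite /tens raddf_sum /= [in RHS](monalgE a) raddf_sum mulr_suml.
apply: eq_bigr => i _; rewrite raddf_sum /= [in RHS](monalgE b) raddf_sum.
rewrite mulr_sumr; apply: eq_bigr => j _.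
by rewrite /= !mcoeffU mulrnAl mulrnAr -mulrnA mulnb andbC; case: (p).
Qed.

Lemma tens_linearl {I J : choiceType} (b : {malg K[J]}) :
  linear (fun a : {malg K[I]} => tens a b).
Proof.
move=> k x y; apply/malgP => p.
by rewrite mcoeffD mcoeffZ !mcoeff_tens mcoeffD mcoeffZ mulrDl mulrA.
Qed.

Lemma tens_linearr {I J : choiceType} (a : {malg K[I]}) :
  linear (fun b : {malg K[J]} => tens a b).
Proof.
move=> k x y; apply/malgP => p.
by rewrite mcoeffD mcoeffZ !mcoeff_tens mcoeffD mcoeffZ mulrDr mulrCA.
Qed.

Lemma tmap_tens {I J I' J' : choiceType}
    (f : {malg K[I]} -> {malg K[I']}) (g : {malg K[J]} -> {malg K[J']}) a b :
  linear f -> linear g -> tmap f g (tens a b) = tens (f a) (g b).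
Proof.
move=> fl gl; rewrite /tmap tliftP // => c k x y.
  by rewrite fl tens_linearl.
by rewrite gl tens_linearr.
Qed.

Lemma tmap_linear {I J I' J' : choiceType}
    (f : {malg K[I]} -> {malg K[I']}) (g : {malg K[J]} -> {malg K[J']}) :
  linear (tmap f g).
Proof. exact: tlift_linear. Qed.

Lemma tassoc_linear {I J L : choiceType} : linear (@tassoc K I J L).
Proof. exact: tlift_linear. Qed.

Lemma tassoc_tens {I J L : choiceType} (a : {malg K[I]}) (b : {malg K[J]})
    (c : {malg K[L]}) :
  tassoc (tens (tens a b) c) = tens a (tens b c).
Proof.
rewrite /tassoc tliftP.
- rewrite tliftP // => d k x y; first by rewrite tens_linearl.
  by rewrite tens_linearl tens_linearr.
- by move=> d k x y; rewrite tlift_linear.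
- move=> d; apply: tlift_linear_param => i j k x y.
  by rewrite !tens_linearr.
Qed.

Lemma tens_ind {I J : choiceType} (P : {malg K[(I * J)%type]} -> Prop) :
  P 0 -> (forall a b, P (tens a b)) ->
  (forall k a b, P a -> P b -> P (k *: a + b)) -> forall a, P a.
Proof. by move=> P0 PU PL; apply: malg_ind => // -[i j]; rewrite -tensU. Qed.

End MalgExt.

Section MonoidAlgebra.
Context {K : fieldType}.

Lemma mulr_malgC {M : monomType} (k : K) (x : {malg K[M]}) :
  x * k%:MP = k%:MP * x.
Proof.
rewrite !malgM_def fgmulgU fgmulUg; apply: eq_bigr => i _.
by rewrite mulrC mulm1 mul1m.
Qed.

Lemma malg_scalerAr {M : monomType} (k : K) (x y : {malg K[M]}) :
  k *: (x * y) = x * (k *: y).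
Proof. by rewrite -!mul_malgC !mulrA mulr_malgC. Qed.

Lemma mulr_linearr {M : monomType} (x : {malg K[M]}) : linear ( *%R x).
Proof. by move=> k a b; rewrite mulrDr -malg_scalerAr. Qed.

Lemma mulr_linearl {C : lalgType K} (x : C) : linear (fun y => y * x).
Proof. by move=> k a b; rewrite mulrDl scalerAl. Qed.

Lemma malgUM {M : monomType} (i j : M) :
  << mmul i j >> = << i >> * << j >> :> {malg K[M]}.
Proof. by rewrite malgM_def fgmulUU mulr1. Qed.

Lemma malgU1 {M : monomType} : << mone >> = 1 :> {malg K[M]}.
Proof. by []. Qed.

(** A [lalgType] moves scalars out of the left factor only, so right linearity of the product of C
    is a hypothesis. Both sides of multiplicativity are then bilinear, and it suffices to compare
    them on monomials. *)
Lemma algebra_morphism_ext {M : monomType} {C : lalgType K} (f : {malg K[M]} -> C) :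
  (forall x : C, linear ( *%R x)) -> linear f -> f << mone >> = 1 ->
  (forall i j, f << mmul i j >> = f << i >> * f << j >>) ->
  algebra_morphism f.
Proof.
move=> Cr fl f1 fM; split=> //; split=> //.
apply: malg_ext2 => [b|a|b|a|i j].
- exact: linear_comp fl (mulr_linearl _).
- exact: linear_comp fl (mulr_linearr _).
- exact: linear_comp (mulr_linearl _) fl.
- exact: linear_comp (Cr _) fl.
- by rewrite -malgUM.
Qed.

Lemma algebra_morphism_comp {A B C : lalgType K} (f : B -> C) (g : A -> B) :
  algebra_morphism f -> algebra_morphism g -> algebra_morphism (f \o g).
Proof.
move=> [fl [f1 fM]] [gl [g1 gM]]; split; first exact: linear_comp.
by split=> [|x y] /=; rewrite ?g1 // gM fM.
Qed.

Lemma algebra_morphism_id {A : lalgType K} : algebra_morphism (@id A).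
Proof. by []. Qed.

Lemma tens1 {M N : monomType} : tens 1 1 = 1 :> {malg K[(M * N)%type]}.
Proof. by rewrite tensU. Qed.

Lemma tmap_morphism {M N M' N' : monomType}
    (f : {malg K[M]} -> {malg K[M']}) (g : {malg K[N]} -> {malg K[N']}) :
  algebra_morphism f -> algebra_morphism g -> algebra_morphism (tmap f g).
Proof.
move=> [fl [f1 fM]] [gl [g1 gM]]; apply: algebra_morphism_ext.
- exact: mulr_linearr.
- exact: tmap_linear.
- by rewrite -tens1 -tensU tmap_tens // f1 g1.
- move=> [i j] [i' j']; rewrite -!tensU !malgUM !tmap_tens // tensM.
  by rewrite -fM -gM.
Qed.

Lemma tassoc_morphism {M N L : monomType} : algebra_morphism (@tassoc K M N L).
Proof.
apply: algebra_morphism_ext.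
- exact: mulr_linearr.
- exact: tassoc_linear.
- by rewrite -!tensU tassoc_tens !tens1.
- have tassocU (i : M) (j : N) (l : L) :
      tassoc << ((i, j), l) >> = << (i, (j, l)) >> :> {malg K[_]}.
    by rewrite -!tensU tassoc_tens.
  move=> [[i j] l] [[i' j'] l']; apply: etrans (tassocU _ _ _) _.
  by rewrite !tassocU -malgUM.
Qed.

End MonoidAlgebra.

(** * Free algebras: morphisms and antimorphisms determined by the generators *)

Section FreeAlgebra.
Context {I : choiceType}.

Lemma word_prod (w : {fmonom I}) :
  << w >> = \prod_(i <- (w : seq I)) gen i :> free_algebra I.
Proof.
case: w; elim=> [|i s IH]; first by rewrite big_nil -malgU1 /mone /= fmoneE.
rewrite big_cons -IH /gen -malgUM; congr << _ >>.
by apply: val_inj; rewrite /= fmM fmU.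
Qed.

Lemma free_ind (P : free_algebra I -> Prop) :
  P 1 -> (forall i a, P a -> P (gen i * a)) ->
  (forall k a b, P a -> P b -> P (k *: a + b)) -> forall a, P a.
Proof.
move=> P1 PM PL; apply: malg_ind => // [|w].
  (* 0 is the combination (-1) *: 1 + 1, so [P 0] follows from [P 1]. *)
  by rewrite -(addNr 1) -scaleN1r; apply: PL.
by rewrite word_prod; elim/big_rec: _ => // i x _; apply: PM.
Qed.

Lemma free_ext {A : lalgType rat} (f g : free_algebra I -> A) :
  algebra_morphism f -> algebra_morphism g ->
  (forall i, f (gen i) = g (gen i)) -> f =1 g.
Proof.
move=> [fl [f1 fM]] [gl [g1 gM]] fg; apply: free_ind => [|i a|k a b].
- by rewrite f1 g1.
- by rewrite fM gM fg => ->.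
- by rewrite fl gl => -> ->.
Qed.

Lemma free_lift_morphism {A : lalgType rat} (f : I -> A) :
  (forall x : A, linear ( *%R x)) -> algebra_morphism (free_lift f).
Proof.
move=> Ar; apply: algebra_morphism_ext => //.
- exact: mlift_linear.
- by rewrite /free_lift mliftU fm1 big_nil.
- by move=> i j; rewrite /free_lift !mliftU fmM big_cat.
Qed.

(** The antimorphism with prescribed values on the generators: an antipode reverses products, so it
    has this form. *)
Definition free_antilift {A : lalgType rat} (f : I -> A) : free_algebra I -> A :=
  mlift (fun w : {fmonom I} => \prod_(i <- rev (w : seq I)) f i).

Lemma free_antilift_gen {A : lalgType rat} (f : I -> A) i :
  free_antilift f (gen i) = f i.
Proof. by rewrite /free_antilift /gen mliftU fmuE big_seq1. Qed.

Lemma free_antilift_linear {A : lalgType rat} (f : I -> A) :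
  linear (free_antilift f).
Proof. exact: mlift_linear. Qed.

Lemma free_antilift1 {A : lalgType rat} (f : I -> A) : free_antilift f 1 = 1.
Proof. by rewrite /free_antilift mliftU fm1 big_nil. Qed.

Lemma free_antiliftM {A : lalgType rat} (f : I -> A) :
  (forall x : A, linear ( *%R x)) ->
  forall a b, free_antilift f (a * b) = free_antilift f b * free_antilift f a.
Proof.
move=> Ar; have Sl := free_antilift_linear f.
apply: malg_ext2 => [b|a|b|a|i j].
- exact: linear_comp Sl (mulr_linearl _).
- exact: linear_comp Sl (mulr_linearr _).
- exact: linear_comp (Ar _) Sl.
- exact: linear_comp (mulr_linearl _) Sl.
- by rewrite -malgUM /free_antilift !mliftU fmM rev_cat big_cat.
Qed.

End FreeAlgebra.

(** * Factorizations of trees *)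

(** [finite_trees] only yields some list that contains the small trees; filtering and [undup] make
    it exact. With the strict bound, [trees (order u)] indexes the part of column u strictly above
    the diagonal. *)
Definition trees (n : nat) : seq tree :=
  [seq t <- undup (sval (cid (finite_trees n))) | (order t < n)%N].

Lemma mem_trees n t : (t \in trees n) = (order t < n)%N.
Proof.
rewrite mem_filter mem_undup; case: (ltnP (order t) n) => //= lt.
exact: (svalP (cid (finite_trees n))) (ltnW lt).
Qed.

Lemma trees_uniq n : uniq (trees n).
Proof. exact/filter_uniq/undup_uniq. Qed.

(** Lets finite lists stand for sums over all trees: only the support of F matters, not the list. *)
Lemma eq_big_support {V : nmodType} {T : eqType} (r1 r2 : seq T) (F : T -> V) :
  uniq r1 -> uniq r2 ->
  (forall x, F x != 0 -> (x \in r1) = (x \in r2)) ->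
  \sum_(x <- r1) F x = \sum_(x <- r2) F x.
Proof.
move=> u1 u2 F12.
rewrite -(@big_rmcond_in _ _ _ _ r1 (fun x => F x != 0)); last first.
  by move=> x _; rewrite negbK => /eqP.
rewrite -[RHS](@big_rmcond_in _ _ _ _ r2 (fun x => F x != 0)); last first.
  by move=> x _; rewrite negbK => /eqP.
rewrite -[LHS]big_filter -[RHS]big_filter; apply: perm_big.
apply: uniq_perm; rewrite ?filter_uniq // => x; rewrite !mem_filter.
by case: eqP => //= /eqP /F12 ->.
Qed.

Lemma big_trees_widen {V : nmodType} m n (F : tree -> V) : (m <= n)%N ->
  (forall t, F t != 0 -> (order t < m)%N) ->
  \sum_(t <- trees n) F t = \sum_(t <- trees m) F t.
Proof.
move=> mn Fm; apply: eq_big_support; rewrite ?trees_uniq // => t /Fm tm.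
by rewrite !mem_trees tm (leq_trans tm).
Qed.

(** The double sum also meets trees of order n or more; the support hypothesis makes F vanish
    there. *)
Lemma big_trees_Node {V : nmodType} n (F : tree -> V) :
  (forall t, F t != 0 -> (order t < n)%N) ->
  \sum_(t <- trees n) F t =
  F Leaf + \sum_(l <- trees n) \sum_(r <- trees n) F (Node l r).
Proof.
move=> Fn; transitivity (\sum_(t <- Leaf ::
    [seq Node l r | l <- trees n, r <- trees n]) F t); last first.
  by rewrite big_cons big_allpairs_dep.
apply: eq_big_support.
- exact: trees_uniq.
- rewrite /= allpairs_uniq ?trees_uniq ?andbT //.
    by apply/negP => /allpairsP[? []].
  by move=> [l r] [l' r'] _ _ /= [-> ->].
- move=> t /Fn tn; rewrite mem_trees tn; case: t tn => // l r /= tn.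
  apply/esym/orP; right; apply: allpairs_f; rewrite mem_trees.
    exact: leq_ltn_trans (leq_addr _ _) (ltnW tn).
  exact: leq_ltn_trans (leq_addl _ _) (ltnW tn).
Qed.

(** The factorizations u = p.1 / p.2 are the cuts of the left branch of u. The trivial cut (u, o)
    comes first, which later proofs use to split it off. *)
Fixpoint over_splits (u : tree) : seq (tree * tree) :=
  (u, Leaf) ::
  if u is Node l r then [seq (p.1, Node p.2 r) | p <- over_splits l] else [::].

Lemma mem_over_splits u p : (p \in over_splits u) = (over p.1 p.2 == u).
Proof.
elim: u p => [|l IH r _] [a [|x y]] //=; rewrite inE.
- by rewrite xpair_eqE eqxx andbT.
- by rewrite xpair_eqE andbF.
- rewrite xpair_eqE eqxx andbT; case: eqP => //= _.
  by apply/negP => /mapP[].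
- rewrite xpair_eqE andbF /=; apply/mapP/eqP => [[[b z]]|[xl <-]].
    by rewrite IH /= => /eqP <- [-> -> ->].
  by exists (a, x) => /=; rewrite ?IH ?xl /=.
Qed.

Lemma over_splits_uniq u : uniq (over_splits u).
Proof.
elim: u => //= l IH r _; rewrite map_inj_uniq ?IH ?andbT.
  by apply/mapP => -[].
by move=> [a x] [b y] /= [-> ->].
Qed.

(** Each pair (a, x) is a cut of exactly one tree, namely a / x. *)
Lemma big_trees_over {V : nmodType} n (F : tree * tree -> V) :
  (forall p, F p != 0 -> (order (over p.1 p.2) < n)%N) ->
  \sum_(t <- trees n) \sum_(p <- over_splits t) F p =
  \sum_(a <- trees n) \sum_(x <- trees n) F (a, x).
Proof.
move=> Fn; rewrite -(big_allpairs_dep (h := fun (_ : tree) (p : tree * tree) => p) (F := F)).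
rewrite -(big_allpairs_dep (h := fun a x : tree => (a, x)) (F := F)).
apply: eq_big_support.
- apply: allpairs_uniq_dep => [|t _|].
  + exact: trees_uniq.
  + exact: over_splits_uniq.
  + move=> _ _ /allpairsPdep[t [p [_ tp ->]]] /allpairsPdep[t' [p' [_ tp' ->]]].
    move=> /= pp'; move: tp tp'; rewrite pp' !mem_over_splits.
    by move=> /eqP <- /eqP <-.
- by apply: allpairs_uniq; rewrite ?trees_uniq // => -[? ?] [? ?].
- move=> [a x] /Fn /= lt; transitivity true; last apply/esym.
    apply/allpairsPdep; exists (over a x), (a, x).
    by rewrite mem_trees lt mem_over_splits eqxx.
  rewrite order_over in lt; apply: allpairs_f; rewrite mem_trees.
    exact: leq_ltn_trans (leq_addr _ _) lt.
  exact: leq_ltn_trans (leq_addl _ _) lt.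
Qed.

(* [mu_factors t u] enumerates the s with u = mu_t (s_1 / v, ..., s_|t| / v),
   and [mu_over_factors t u] those with u = mu_t (s_1 / v, ...) / s_(|t|+1). *)
Fixpoint mu_factors (t u : tree) : seq (seq tree) :=
  match t, u with
  | Leaf, Leaf => [:: [::]]
  | Node l r, Node a b =>
      [seq s1 ++ s2
        | s1 <- [seq rcons s p.2 | p <- over_splits a, s <- mu_factors l p.1],
          s2 <- mu_factors r b]
  | _, _ => [::]
  end.

Definition mu_over_factors (t u : tree) : seq (seq tree) :=
  [seq rcons s p.2 | p <- over_splits u, s <- mu_factors t p.1].

(** The entry x of index [order l] replaces the middle v of t^l / v \ t^r. By associativity, mu_l /
    (x / v) = (mu_l / x) / v, so the left subtree of the result is mu_l / x. This is why
    [mu_factors] cuts the left subtree once more. *)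
Lemma mu_Node_rcons l r s1 x s2 : size s1 = order l ->
  mu (Node l r) [seq over y vertex | y <- rcons s1 x ++ s2] =
  Node (over (mu l [seq over y vertex | y <- s1]) x)
       (mu r [seq over y vertex | y <- s2]).
Proof.
move=> sz; rewrite /= -cats1 -catA /= map_cat take_size_cat ?size_map //=.
rewrite nth_cat size_map sz ltnn subnn /=.
by rewrite drop_cat size_map sz ltnNge leqnSn /= subSn // subnn /= drop0.
Qed.

(** The statement about [mu_factors t] is a hypothesis because the lemma serves inside the induction
    that proves it, at the left subtree. The later lemmas in [_aux] follow the same pattern. *)
Lemma mem_mu_over_factors_aux t :
  (forall u s, (s \in mu_factors t u) =
    (size s == order t) && (u == mu t [seq over x vertex | x <- s])) ->
  forall u s x, (rcons s x \in mu_over_factors t u) =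
    (size s == order t) && (u == over (mu t [seq over x vertex | x <- s]) x).
Proof.
move=> IH u s x; apply/allpairsPdep/andP => [[p [s' []]]|[sz /eqP uE]].
  rewrite mem_over_splits IH => /eqP <- /andP[sz /eqP p1] /rcons_inj[-> ->].
  by rewrite sz -p1.
exists (mu t [seq over x vertex | x <- s], x), s.
by rewrite mem_over_splits IH /= sz uE eqxx.
Qed.

Lemma mem_mu_factors t u s : (s \in mu_factors t u) =
  (size s == order t) && (u == mu t [seq over x vertex | x <- s]).
Proof.
elim: t u s => [|l IHl r IHr] u s.
  by case: u s => [|? ?] [|? ?].
case: u => [|a b] /=.
  apply/esym/negP => /andP[/eqP sz].
  by rewrite (nth_map Leaf) // sz ltnS leq_addr.
rewrite -/(mu_over_factors l a); apply/allpairsP/idP => [[[s1 s2]] /=|].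
  case: (lastP s1) => [|{}s1 x] [].
    by move=> /allpairsPdep[p [[|? ?] []]].
  rewrite mem_mu_over_factors_aux // IHr => /andP[/eqP sz1 /eqP aE].
  move=> /andP[/eqP sz2 /eqP bE] ->.
  rewrite size_cat size_rcons sz1 sz2 addSn eqxx /=.
  by have /= -> := @mu_Node_rcons l r s1 x s2 sz1; rewrite -aE -bE.
move=> /andP[/eqP sz]; have lt : (order l < size s)%N by rewrite sz ltnS leq_addr.
have sE : s = rcons (take (order l) s) (nth Leaf s (order l)) ++ drop (order l).+1 s.
  by rewrite -take_nth // cat_take_drop.
have sz1 : size (take (order l) s) = order l by rewrite size_takel // ltnW.
have sz2 : size (drop (order l).+1 s) = order r by rewrite size_drop sz subSS addKn.
move: sE sz1 sz2; move: (take _ _) (nth _ _ _) (drop _ _) => s1 x s2 -> sz1 sz2.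
have /= -> := @mu_Node_rcons l r s1 x s2 sz1 => /eqP[aE bE].
exists (rcons s1 x, s2) => /=; split=> //.
  by rewrite mem_mu_over_factors_aux // sz1 eqxx -aE /=.
by rewrite IHr sz2 eqxx -bE /=.
Qed.

Lemma mem_mu_over_factors t u s : (s \in mu_over_factors t u) =
  (size s == (order t).+1) &&
  (u == over (mu t [seq over x vertex | x <- take (order t) s]) (last Leaf s)).
Proof.
case: (lastP s) => [|{}s x].
  by rewrite /=; apply/negP => /allpairsPdep[p [[|? ?] []]].
rewrite mem_mu_over_factors_aux; last exact: mem_mu_factors.
rewrite size_rcons eqSS last_rcons; case: eqP => //= <-.
by rewrite -cats1 take_size_cat.
Qed.

(** A sequence determines the cut it comes from: its last entry is p.2, and p.1 is the t-product of
    the others. Without repetitions, summing over the list equals summing over the index set of the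
    coproduct. *)
Lemma mu_over_factors_uniq t u :
  (forall a, uniq (mu_factors t a)) -> uniq (mu_over_factors t u).
Proof.
move=> IH; apply: allpairs_uniq_dep => //; first exact: over_splits_uniq.
move=> _ _ /allpairsPdep[p [s [up sp ->]]] /allpairsPdep[p' [s' [up' sp' ->]]] /=.
move=> /rcons_inj[ss' pp']; move: sp sp' up up'.
rewrite ss' !mem_mu_factors !mem_over_splits => /andP[_ /eqP p1] /andP[_ /eqP p1'].
by case: p p' p1 p1' pp' {ss'} => [? ?] [? ?] /= -> -> ->.
Qed.

(** The first block of a concatenation always has length [order l] + 1, so the two blocks can be
    recovered. *)
Lemma mu_factors_uniq t u : uniq (mu_factors t u).
Proof.
elim: t u => [|l IHl r IHr] [|a b] //=; rewrite -/(mu_over_factors l a).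
apply: allpairs_uniq; rewrite ?mu_over_factors_uniq //.
move=> [s1 s2] [s1' s2'] /allpairsP[[? ?] [/= + _ [-> _]]].
move=> + /allpairsP[[? ?] [/= + _ [-> _]]].
rewrite !mem_mu_over_factors => /andP[/eqP sz _] /andP[/eqP sz' _] /eqP.
by rewrite eqseq_cat ?sz ?sz' // => /andP[/eqP-> /eqP->].
Qed.

Lemma coproduct_indexE u n : (order u < n)%N ->
  coproduct_index u =
  [set` [seq (t, s) | t <- pmap insub (trees n) : seq Ybar,
                      s <- mu_over_factors (val t) u]]%classic.
Proof.
move=> un; apply/seteqP; split=> -[t s] /=.
  move=> [sz uE]; apply: allpairs_f_dep.
    rewrite mem_pmap_sub mem_trees; apply: leq_ltn_trans un.
    rewrite uE order_over order_mu ?size_map ?size_takel ?sz ?leqnSn //.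
    apply: leq_trans (leq_addr _ _); rewrite big_map.
    (* Each factor x / v has order at least 1, so the t-product has order at least [order t]. *)
    rewrite -[leqLHS](_ : \sum_(x <- take (order (val t)) s) 1 = _)%N; last first.
      by rewrite sum1_size size_takel // sz.
    by apply: leq_sum => x _; rewrite order_over addn1.
  by rewrite mem_mu_over_factors sz eqxx -uE /=.
move=> /allpairsPdep[t' [s' [_ + [-> ->]]]].
by rewrite mem_mu_over_factors => /andP[/eqP sz /eqP uE].
Qed.

(** * The coproduct as a unitriangular matrix *)

Section TensSum.
Context {K : fieldType} {I J : choiceType}.

Lemma tens0l (b : {malg K[J]}) : tens (0 : {malg K[I]}) b = 0.
Proof. exact: (linear_fun0 (tens_linearl b)). Qed.

Lemma tens0r (a : {malg K[I]}) : tens a (0 : {malg K[J]}) = 0.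
Proof. exact: (linear_fun0 (tens_linearr a)). Qed.

Lemma tens_suml (T : Type) (r : seq T) (F : T -> {malg K[I]}) (b : {malg K[J]}) :
  tens (\sum_(i <- r) F i) b = \sum_(i <- r) tens (F i) b.
Proof. exact: (linear_fun_sum (tens_linearl b)). Qed.

Lemma tens_sumr (T : Type) (r : seq T) (F : T -> {malg K[J]}) (a : {malg K[I]}) :
  tens a (\sum_(i <- r) F i) = \sum_(i <- r) tens a (F i).
Proof. exact: (linear_fun_sum (tens_linearr a)). Qed.

End TensSum.

(** Both sides run over the triples with x / y / z = u, bracketed in the two possible ways. *)
Lemma big_over_splitsA {V : nmodType} (G : tree -> tree -> tree -> V) u :
  \sum_(p <- over_splits u) \sum_(q <- over_splits p.2) G p.1 q.1 q.2 =
  \sum_(p <- over_splits u) \sum_(q <- over_splits p.1) G q.1 q.2 p.2.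
Proof.
elim: u G => [|l IH r _] G; first by rewrite /= !big_seq1.
rewrite /= !big_cons !big_map /= big_nil addr0.
under eq_bigr do rewrite big_cons big_map /=.
rewrite big_split /= addrA; congr (_ + _).
exact: (IH (fun x y z => G x y (Node z r))).
Qed.

Lemma ygen_Leaf : ygen Leaf = 1.
Proof. by rewrite /ygen insubF. Qed.

Lemma ygen_val (u : Ybar) : ygen (val u) = gen u.
Proof. by rewrite /ygen valK. Qed.

(** The coefficient of u in M_t; [mu_over_coef] is f(t, u), the coefficient of u in F_t. *)
HB.lock Definition mu_coef (t u : tree) : HY :=
  \sum_(s <- mu_factors t u) \prod_(x <- s) ygen x.

HB.lock Definition mu_over_coef (t u : tree) : HY :=
  \sum_(s <- mu_over_factors t u) \prod_(x <- s) ygen x.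

Lemma mu_over_coefE t u :
  mu_over_coef t u = \sum_(p <- over_splits u) mu_coef t p.1 * ygen p.2.
Proof.
rewrite mu_over_coef.unlock mu_coef.unlock big_allpairs_dep; apply: eq_bigr => p _.
by rewrite mulr_suml; apply: eq_bigr => s _; rewrite -cats1 big_cat big_seq1.
Qed.

Lemma mu_coef_Leafl u : mu_coef Leaf u = (u == Leaf)%:R.
Proof. by case: u => [|a b]; rewrite mu_coef.unlock /= ?big_seq1 big_nil. Qed.

Lemma mu_coef_Leafr t : mu_coef t Leaf = (t == Leaf)%:R.
Proof. by case: t => [|a b]; rewrite mu_coef.unlock /= ?big_seq1 big_nil. Qed.

Lemma mu_coef_Node l r a b :
  mu_coef (Node l r) (Node a b) = mu_over_coef l a * mu_coef r b.
Proof.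
rewrite mu_over_coef.unlock mu_coef.unlock /= -/(mu_over_factors l a) big_allpairs_dep mulr_suml.
apply: eq_bigr => s _; rewrite mulr_sumr; apply: eq_bigr => s' _.
by rewrite big_cat.
Qed.

Lemma mu_over_coef_Leafl u : mu_over_coef Leaf u = ygen u.
Proof.
rewrite mu_over_coefE (bigD1_seq (Leaf, u)) ?over_splits_uniq //=; last first.
  by rewrite mem_over_splits /= over0t.
rewrite mu_coef_Leafl eqxx mul1r big1_seq ?addr0 // => -[a x] /=.
rewrite mem_over_splits /= mu_coef_Leafl => /andP[+ /eqP E].
case: (a =P Leaf) E => [->|_ _ _]; last by rewrite mul0r.
by rewrite over0t => ->; rewrite eqxx.
Qed.

Lemma mu_over_coef_over t t' u : mu_over_coef (over t t') u =
  \sum_(p <- over_splits u) mu_coef t p.1 * mu_over_coef t' p.2.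
Proof.
elim: t' u => [|l IH r _] u.
  by rewrite mu_over_coefE; apply: eq_bigr => p _; rewrite mu_over_coef_Leafl.
rewrite [over _ _]/=.
(* This is M_(t / t') = M_t / M_t' for t' = [Node l r]. The trivial cut (v, o) contributes nothing,
   since M_t' has no term o. *)
have muE v : mu_coef (Node (over t l) r) v =
    \sum_(q <- over_splits v) mu_coef t q.1 * mu_coef (Node l r) q.2.
  case: v => [|a b] /=; first by rewrite big_seq1 !mu_coef_Leafr mulr0.
  rewrite big_cons mu_coef_Leafr mulr0 add0r big_map mu_coef_Node IH mulr_suml.
  by apply: eq_bigr => p _; rewrite mu_coef_Node mulrA.
(* The triples of M_t / M_t' / P; rebracketing them makes F_t' = M_t' / P appear. *)
pose G x y z := mu_coef t x * (mu_coef (Node l r) y * ygen z).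
transitivity (\sum_(p <- over_splits u) \sum_(q <- over_splits p.1)
    G q.1 q.2 p.2).
  rewrite mu_over_coefE; apply: eq_bigr => p _; rewrite muE mulr_suml.
  by apply: eq_bigr => q _; rewrite -mulrA.
rewrite -big_over_splitsA; apply: eq_bigr => p _.
by rewrite mu_over_coefE mulr_sumr.
Qed.

Lemma mu_over_coef_small_aux t :
  (forall u, (order u <= order t)%N -> mu_coef t u = (t == u)%:R) ->
  forall u, (order u <= order t)%N -> mu_over_coef t u = (t == u)%:R.
Proof.
move=> IH u ut; rewrite mu_over_coefE.
(* Beyond the trivial cut, the first part is strictly smaller than t, and its coefficient in M_t is
   0. *)
have -> : over_splits u = (u, Leaf) :: behead (over_splits u) by case: u {ut}.
rewrite big_cons /= IH // ygen_Leaf mulr1 big1_seq ?addr0 // => p /andP[_].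
case: u ut => //= l r ut /mapP[[a x]]; rewrite mem_over_splits => /= /eqP E -> /=.
have at_ : (order a < order t)%N.
  apply: leq_trans ut; rewrite ltnS -E order_over -addnA leq_addr //.
rewrite IH ?(ltnW at_) //; case: eqP at_ => [->|]; first by rewrite ltnn.
by rewrite mul0r.
Qed.

(** A t-product of the s_i / v has order |t| plus the orders of the s_i. If this is at most |t|, all
    the s_i are o, the product is t itself, and its coefficient is 1. *)
Lemma mu_coef_small t u :
  (order u <= order t)%N -> mu_coef t u = (t == u)%:R.
Proof.
elim: t u => [|l IHl r IHr] u.
  by rewrite mu_coef_Leafl eq_sym.
case: u => [|a b]; first by rewrite mu_coef_Leafr.
rewrite /= ltnS mu_coef_Node => le.
have -> : (Node l r == Node a b) = (l == a) && (r == b).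
  by apply/eqP/andP => [[-> ->]|[/eqP-> /eqP->]].
(* Only the sum of the orders of a and b is bounded. Either a is small enough for the left factor,
   or b is strictly smaller than r and the right factor vanishes. *)
have [al|la] := leqP (order a) (order l).
  rewrite (mu_over_coef_small_aux IHl) //; case: eqP => [E|_]; last by rewrite mul0r.
  by rewrite mul1r IHr //; move: le; rewrite E leq_add2l.
rewrite IHr; last first.
  by rewrite -(leq_add2l (order a)) (leq_trans le) // leq_add2r ltnW.
have rb : (order b < order r)%N.
  by rewrite -(ltn_add2l (order l)) (leq_trans _ le) // ltn_add2r.
case: (r =P b) rb => [->|_ _]; first by rewrite ltnn.
by rewrite andbF mulr0.
Qed.

Lemma mu_over_coef_small t u :
  (order u <= order t)%N -> mu_over_coef t u = (t == u)%:R.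
Proof. exact: (mu_over_coef_small_aux (@mu_coef_small t)). Qed.

Lemma mu_coef_gt t u : (order u < order t)%N -> mu_coef t u = 0.
Proof.
move=> ut; rewrite mu_coef_small ?(ltnW ut) //.
by case: eqP ut => // ->; rewrite ltnn.
Qed.

Lemma mu_over_coef_gt t u : (order u < order t)%N -> mu_over_coef t u = 0.
Proof.
move=> ut; rewrite mu_over_coef_small ?(ltnW ut) //.
by case: eqP ut => // ->; rewrite ltnn.
Qed.

Lemma mu_coef_neq0 t u n : (order u < n)%N -> mu_coef t u != 0 -> (order t < n)%N.
Proof.
move=> un; case: (leqP (order t) (order u)) => [tu _|/mu_coef_gt->].
  exact: leq_ltn_trans un.
by rewrite eqxx.
Qed.

Lemma mu_over_coef_neq0 t u n :
  (order u < n)%N -> mu_over_coef t u != 0 -> (order t < n)%N.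
Proof.
move=> un; case: (leqP (order t) (order u)) => [tu _|/mu_over_coef_gt->].
  exact: leq_ltn_trans un.
by rewrite eqxx.
Qed.

Lemma coproduct_morphism : algebra_morphism coproduct.
Proof. by apply: free_lift_morphism => x; apply: mulr_linearr. Qed.

(** The summand t = o is the term 1 (x) u, and u = o is covered as well. The bound n is free, so
    that different trees can share one index list. *)
Lemma coproduct_ygen u n : (order u < n)%N ->
  coproduct (ygen u) = \sum_(t <- trees n) tens (ygen t) (mu_over_coef t u).
Proof.
move=> un; rewrite (bigD1_seq Leaf) ?trees_uniq ?mem_trees ?(leq_trans _ un) //=.
rewrite ygen_Leaf mu_over_coef_Leafl; have [_ [D1 _]] := coproduct_morphism.
case: (altP (u =P Leaf)) un => [-> _|u0 un].
  rewrite ygen_Leaf D1 tens1 big1 ?addr0 // => t t0.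
  by rewrite mu_over_coef_small // (negbTE t0) tens0r.
have [v uv] : exists v : Ybar, u = val v by exists (Sub u u0).
rewrite {u u0}uv in un *.
rewrite ygen_val /coproduct free_lift_gen /coproduct_gen; congr (_ + _).
(* The finitely supported sum over the index set becomes a sum over a duplicate-free list. *)
rewrite (coproduct_indexE un) -fsbig_seq; last first.
  apply: allpairs_uniq_dep => [|t _|].
  - by rewrite pmap_sub_uniq ?trees_uniq.
  - exact/mu_over_factors_uniq/mu_factors_uniq.
  - by move=> [t s] [t' s'] _ _ /= [-> ->].
rewrite big_allpairs_dep big_pmap [RHS]big_mkcond; apply: eq_bigr => t _.
case: insubP => [t' t0 tt'|]; last by rewrite negbK => /eqP ->.
rewrite t0 -tt' /= ygen_val mu_over_coef.unlock tens_sumr.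
by [].
Qed.

(** * Coassociativity, the counit and the bialgebra axioms *)

Section Counit.
Context {K : fieldType} {M : monomType}.
Local Notation A := {malg K[M]}.
Variables (e : A -> K) (em : @algebra_morphism K A K^o e).

Lemma algebra_morphism_scalel (b : A) : linear (fun a : A => e a *: b).
Proof. by have [el _] := em; move=> k x y; rewrite el scalerDl scalerA. Qed.

Lemma scaler_linearr {W : lmodType K} (k : K) : linear (fun b : W => k *: b).
Proof. by move=> l x y; rewrite scalerDr !scalerA mulrC. Qed.

Lemma tlift_scalel_tens (b c : A) :
  tlift (fun b c : A => e b *: c) (tens b c) = e b *: c.
Proof.
by apply: tliftP => x; [exact: algebra_morphism_scalel | exact: scaler_linearr].
Qed.

Lemma tlift_scaler_tens (b c : A) :
  tlift (fun b c : A => e c *: b) (tens b c) = e c *: b.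
Proof.
by apply: tliftP => x; [exact: scaler_linearr | exact: algebra_morphism_scalel].
Qed.

Lemma scalerM (k l : K) (x y : A) : (k * l) *: (x * y) = (k *: x) * (l *: y).
Proof. by rewrite -scalerAl -malg_scalerAr scalerA. Qed.

Lemma tlift_scalel_morphism : algebra_morphism (tlift (fun b c : A => e b *: c)).
Proof.
have [_ [e1 eM]] := em; apply: algebra_morphism_ext.
- exact: mulr_linearr.
- exact: tlift_linear.
- by rewrite tliftU e1 scale1r.
- move=> [i j] [i' j']; rewrite !tliftU /=.
  by rewrite !malgUM eM scalerM.
Qed.

Lemma tlift_scaler_morphism : algebra_morphism (tlift (fun b c : A => e c *: b)).
Proof.
have [_ [e1 eM]] := em; apply: algebra_morphism_ext.
- exact: mulr_linearr.
- exact: tlift_linear.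
- by rewrite tliftU e1 scale1r.
- move=> [i j] [i' j']; rewrite !tliftU /=.
  by rewrite !malgUM eM scalerM.
Qed.

End Counit.

(** Expand F_w = M_w / P over the cuts of u and apply Delta to both factors. For fixed a and x, the
    left tensor factor is the (a, x) term of M_w / P, and the right ones add up to the coefficient
    of u in M_a / F_x = F_(a / x). Grouping the pairs by t = a / x gives the claim. *)
Lemma coproduct_mu_over_coef_aux w :
  (forall u n, (order u < n)%N -> coproduct (mu_coef w u) =
    \sum_(t <- trees n) tens (mu_coef w t) (mu_coef t u)) ->
  forall u n, (order u < n)%N -> coproduct (mu_over_coef w u) =
    \sum_(t <- trees n) tens (mu_over_coef w t) (mu_over_coef t u).
Proof.
move=> IH u n un; have [Dl [_ DM]] := coproduct_morphism.
pose F (p : tree * tree) := tens (mu_coef w p.1 * ygen p.2)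
  (mu_over_coef (over p.1 p.2) u).
transitivity (\sum_(x <- trees n) \sum_(p <- over_splits x) F p); last first.
  apply: eq_bigr => x _; rewrite [mu_over_coef w x]mu_over_coefE tens_suml.
  by apply: eq_big_seq => p; rewrite mem_over_splits /F => /eqP ->.
rewrite big_trees_over; last first.
  move=> p Fp; apply: mu_over_coef_neq0 un _.
  by apply: contra_neq Fp => E; rewrite /F E tens0r.
rewrite mu_over_coefE (linear_fun_sum Dl).
transitivity (\sum_(p <- over_splits u) \sum_(a <- trees n) \sum_(x <- trees n)
    tens (mu_coef w a * ygen x) (mu_coef a p.1 * mu_over_coef x p.2)).
  apply: eq_big_seq => p; rewrite mem_over_splits => /eqP pu.
  have [lt1 lt2] : (order p.1 < n)%N /\ (order p.2 < n)%N.
    move: un; rewrite -pu order_over => lt; split; apply: leq_ltn_trans lt.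
      exact: leq_addr.
    exact: leq_addl.
  rewrite DM (IH _ n) // (coproduct_ygen (n := n)) // mulr_suml.
  apply: eq_bigr => a _; rewrite mulr_sumr; apply: eq_bigr => x _.
  exact: tensM.
rewrite exchange_big; apply: eq_bigr => a _; rewrite exchange_big.
apply: eq_bigr => x _; rewrite /F mu_over_coef_over tens_sumr.
by [].
Qed.

(** At a node, the coefficient is a product over the two subtrees and Delta is multiplicative; the
    resulting double sum over t and t' is the sum over the trees [Node t t']. *)
Lemma coproduct_mu_coef w u n : (order u < n)%N -> coproduct (mu_coef w u) =
  \sum_(t <- trees n) tens (mu_coef w t) (mu_coef t u).
Proof.
have [Dl [D1 DM]] := coproduct_morphism.
elim: w u n => [|l IHl r IHr] u n un.
  rewrite (bigD1_seq Leaf) ?trees_uniq ?mem_trees ?(leq_trans _ un) //=.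
  rewrite !mu_coef_Leafl eqxx big1 ?addr0 => [|t t0].
    by case: (u == Leaf); rewrite ?tens0r ?tens1 // (linear_fun0 Dl).
  by rewrite mu_coef_Leafl (negbTE t0) tens0l.
rewrite big_trees_Node; last first.
  move=> t Ft; apply: mu_coef_neq0 un _.
  by apply: contra_neq Ft => ->; rewrite tens0r.
rewrite mu_coef_Leafr tens0l add0r; case: u un => [|a b] un.
  rewrite mu_coef_Leafr (linear_fun0 Dl) big1 // => a _; rewrite big1 // => b _.
  by rewrite [mu_coef _ Leaf]mu_coef_Leafr tens0r.
have [lta ltb] : (order a < n)%N /\ (order b < n)%N.
  split; apply: leq_trans un; rewrite ltnS /=.
    exact/leqW/leq_addr.
  exact/leqW/leq_addl.
rewrite mu_coef_Node DM (coproduct_mu_over_coef_aux IHl lta) (IHr _ _ ltb).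
rewrite mulr_suml; apply: eq_bigr => t _; rewrite mulr_sumr.
by apply: eq_bigr => t' _; rewrite !mu_coef_Node tensM.
Qed.

Lemma coproduct_mu_over_coef w u n :
  (order u < n)%N -> coproduct (mu_over_coef w u) =
  \sum_(t <- trees n) tens (mu_over_coef w t) (mu_over_coef t u).
Proof. by apply: coproduct_mu_over_coef_aux => {}u {}n; apply: coproduct_mu_coef. Qed.

Lemma counit_morphism : @algebra_morphism rat HY rat^o counit.
Proof.
apply: (@free_lift_morphism Ybar rat^o) => x k a b.
by rewrite /= mulrDr /GRing.scale /= mulrCA.
Qed.

Lemma counit_sum (T : Type) (r : seq T) (F : T -> HY) :
  counit (\sum_(i <- r) F i) = \sum_(i <- r) counit (F i).
Proof. by have [el _] := counit_morphism; apply: (linear_fun_sum el). Qed.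

Lemma counitM a b : counit (a * b) = counit a * counit b.
Proof. by have [_ [_ eM]] := counit_morphism; apply: eM. Qed.

Lemma counit1 : counit 1 = 1.
Proof. by have [_ [e1 _]] := counit_morphism. Qed.

Lemma counit_gen u : counit (gen u) = 0.
Proof. exact: (@free_lift_gen Ybar rat^o). Qed.

Lemma counit0 : counit 0 = 0.
Proof. by have [el _] := counit_morphism; apply: (linear_fun0 el). Qed.

Lemma counit_ygen u : counit (ygen u) = (u == Leaf)%:R.
Proof.
rewrite /ygen; case: insubP => [v u0 _|]; first by rewrite /= counit_gen (negbTE u0).
by rewrite negbK => ->; exact: counit1.
Qed.

Lemma counit_mu_over_coef_aux t :
  (forall u, counit (mu_coef t u) = (t == u)%:R) ->
  forall u, counit (mu_over_coef t u) = (t == u)%:R.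
Proof.
move=> IH u; rewrite mu_over_coefE counit_sum.
rewrite (bigD1_seq (u, Leaf)) ?over_splits_uniq ?mem_over_splits //=.
rewrite [X in _ + X]big1_seq ?addr0 => [|[a x] /=].
  by rewrite counitM IH ygen_Leaf counit1 mulr1.
rewrite mem_over_splits /= => /andP[+ /eqP E]; rewrite counitM counit_ygen.
by case: (x =P Leaf) E => [->|]; rewrite ?mulr0 //= => ->; rewrite eqxx.
Qed.

(** The counit kills every word with an entry other than o, and the t-product of copies of v is
    t. *)
Lemma counit_mu_coef t u : counit (mu_coef t u) = (t == u)%:R.
Proof.
elim: t u => [|l IHl r IHr] u.
  rewrite mu_coef_Leafl eq_sym.
  by case: (_ == _); rewrite ?counit1 ?counit0.
case: u => [|a b]; first by rewrite mu_coef_Leafr counit0.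
rewrite mu_coef_Node counitM counit_mu_over_coef_aux // IHr -natrM mulnb.
by congr (_ : bool)%:R; apply/andP/eqP => [[/eqP-> /eqP->]|[-> ->]].
Qed.

Lemma counit_mu_over_coef t u : counit (mu_over_coef t u) = (t == u)%:R.
Proof. exact/counit_mu_over_coef_aux/counit_mu_coef. Qed.

Lemma coproduct_coassoc a :
  tassoc (tmap coproduct id (coproduct a)) = tmap id coproduct (coproduct a).
Proof.
have Dm := coproduct_morphism; have [Dl _] := Dm.
have idm : algebra_morphism (@id HY) by exact: algebra_morphism_id.
move: a; apply: (free_ext (f := tassoc \o (tmap coproduct id \o coproduct))
  (g := tmap id coproduct \o coproduct)).
- apply: algebra_morphism_comp tassoc_morphism _.
  exact: algebra_morphism_comp (tmap_morphism Dm idm) Dm.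
- exact: algebra_morphism_comp (tmap_morphism idm Dm) Dm.
move=> u /=; rewrite -ygen_val.
have un : (order (val u) < (order (val u)).+1)%N by [].
rewrite (coproduct_ygen un).
rewrite (linear_fun_sum (tmap_linear _ _)) (linear_fun_sum (tmap_linear _ _)).
rewrite (linear_fun_sum tassoc_linear).
(* Both sides are the sum of the [w] (x) f(w, t) (x) f(t, u) over all w and t. *)
transitivity (\sum_(t <- trees (order (val u)).+1) \sum_(w <- trees (order (val u)).+1)
  tens (ygen w) (tens (mu_over_coef w t) (mu_over_coef t (val u)))).
  apply: eq_big_seq => t; rewrite mem_trees => tn.
  rewrite tmap_tens // (coproduct_ygen tn) tens_suml (linear_fun_sum tassoc_linear).
  by apply: eq_bigr => w _; rewrite tassoc_tens.
rewrite exchange_big; apply: eq_bigr => w _.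
by rewrite tmap_tens // (coproduct_mu_over_coef _ un) tens_sumr.
Qed.

Lemma coproduct_counitl a :
  tlift (fun b c : HY => counit b *: c) (coproduct a) = a.
Proof.
have Tm := tlift_scalel_morphism counit_morphism.
have TE := tlift_scalel_tens counit_morphism.
move: a; apply: (free_ext
  (f := tlift (fun b c : HY => counit b *: c) \o coproduct) (g := id)) => [||u].
- exact: algebra_morphism_comp Tm coproduct_morphism.
- exact: algebra_morphism_id.
have un : (order (val u) < (order (val u)).+1)%N by [].
rewrite /= -ygen_val (coproduct_ygen un) (linear_fun_sum (tlift_linear _)).
rewrite (bigD1_seq Leaf) ?trees_uniq ?mem_trees //=.
rewrite [X in _ + X]big1 ?addr0 => [|t t0].
  by rewrite TE ygen_Leaf counit1 scale1r mu_over_coef_Leafl.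
by rewrite TE counit_ygen (negbTE t0) scale0r.
Qed.

Lemma coproduct_counitr a :
  tlift (fun b c : HY => counit c *: b) (coproduct a) = a.
Proof.
have Tm := tlift_scaler_morphism counit_morphism.
have TE := tlift_scaler_tens counit_morphism.
move: a; apply: (free_ext
  (f := tlift (fun b c : HY => counit c *: b) \o coproduct) (g := id)) => [||u].
- exact: algebra_morphism_comp Tm coproduct_morphism.
- exact: algebra_morphism_id.
have un : (order (val u) < (order (val u)).+1)%N by [].
rewrite /= -ygen_val (coproduct_ygen un) (linear_fun_sum (tlift_linear _)).
rewrite (bigD1_seq (val u)) ?trees_uniq ?mem_trees //=.
rewrite [X in _ + X]big1 ?addr0 => [|t tu].
  by rewrite TE counit_mu_over_coef eqxx scale1r.
by rewrite TE counit_mu_over_coef (negbTE tu) scale0r.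
Qed.

Lemma coproduct_bialgebra : bialgebra coproduct counit.
Proof.
split.
- exact: coproduct_morphism.
- exact: counit_morphism.
- exact: coproduct_coassoc.
- exact: coproduct_counitl.
- exact: coproduct_counitr.
Qed.

(** * The antipode *)

Section Convolution.
Context {K : fieldType} {M : monomType}.
Local Notation A := {malg K[M]}.
Variables (S : A -> A) (Sl : linear S) (SM : forall a b, S (a * b) = S b * S a).

Definition convl (x : {malg K[(M * M)%type]}) : A := tlift *%R (tmap S id x).
Definition convr (x : {malg K[(M * M)%type]}) : A := tlift *%R (tmap id S x).

Lemma tlift_mul_tens (a b : A) : tlift *%R (tens a b) = a * b.
Proof. by apply: tliftP => x; [exact: mulr_linearl | exact: mulr_linearr]. Qed.

Lemma convl_linear : linear convl.
Proof. exact: linear_comp (tlift_linear _) (tmap_linear _ _). Qed.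

Lemma convr_linear : linear convr.
Proof. exact: linear_comp (tlift_linear _) (tmap_linear _ _). Qed.

Lemma convl_tens a b : convl (tens a b) = S a * b.
Proof. by rewrite /convl tmap_tens // tlift_mul_tens. Qed.

Lemma convr_tens a b : convr (tens a b) = a * S b.
Proof. by rewrite /convr tmap_tens // tlift_mul_tens. Qed.

(** S reverses products, so a further tensor factor wraps around the value already obtained instead
    of interleaving with it. *)
Lemma convl_tensr x a b : convl (x * tens a b) = S a * convl x * b.
Proof.
have Tl := convl_linear; move: x; apply: tens_ind => [|c d|k x y xE yE].
- by rewrite mul0r (linear_fun0 Tl) mulr0 mul0r.
- by rewrite tensM !convl_tens SM !mulrA.
- rewrite mulrDl -scalerAl Tl xE yE Tl mulrDr mulrDl; congr (_ + _).
  by rewrite -malg_scalerAr -scalerAl.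
Qed.

Lemma convr_tensl y a b : convr (tens a b * y) = a * convr y * S b.
Proof.
have Tl := convr_linear; move: y; apply: tens_ind => [|c d|k x y xE yE].
- by rewrite mulr0 (linear_fun0 Tl) mulr0 mul0r.
- by rewrite tensM !convr_tens SM !mulrA.
- rewrite mulrDr -malg_scalerAr Tl xE yE Tl mulrDr mulrDl; congr (_ + _).
  by rewrite -malg_scalerAr -scalerAl.
Qed.

(** A scalar in the innermost position can be moved out of the wrapping; this carries the left
    antipode law from factors to products. *)
Lemma convlM k x y : convl x = k%:A -> convl (x * y) = k *: convl y.
Proof.
have Tl := convl_linear; move=> xk; move: y; apply: tens_ind => [|c d|l u v uE vE].
- by rewrite mulr0 (linear_fun0 Tl) scaler0.
- by rewrite convl_tensr convl_tens xk -malg_scalerAr mulr1 scalerAl.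
- rewrite mulrDr -malg_scalerAr Tl uE vE Tl scalerDr !scalerA.
  by rewrite [l * k]mulrC.
Qed.

Lemma convrM k x y : convr y = k%:A -> convr (x * y) = k *: convr x.
Proof.
have Tl := convr_linear; move=> yk; move: x; apply: tens_ind => [|c d|l u v uE vE].
- by rewrite mul0r (linear_fun0 Tl) scaler0.
- by rewrite convr_tensl convr_tens yk -malg_scalerAr mulr1 scalerAl.
- rewrite mulrDl -scalerAl Tl uE vE Tl scalerDr !scalerA.
  by rewrite [l * k]mulrC.
Qed.

End Convolution.

(** The form in which unitriangularity is used: among the trees of top order only the diagonal term
    survives. *)
Lemma big_trees_recr {V : nmodType} u (F : tree -> V) :
  (forall t, order t = order u -> t != u -> F t = 0) ->
  \sum_(t <- trees (order u).+1) F t = F u + \sum_(t <- trees (order u)) F t.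
Proof.
move=> F0; transitivity (\sum_(t <- u :: trees (order u)) F t); last first.
  by rewrite big_cons.
apply: eq_big_support.
- exact: trees_uniq.
- by rewrite /= mem_trees ltnn trees_uniq.
- move=> t Ft; rewrite inE !mem_trees ltnS leq_eqVlt; congr (_ || _).
  apply/eqP/eqP => [tu|-> //]; apply/eqP; apply: contraNT Ft => tNu.
  by apply/eqP/F0.
Qed.

Lemma big_trees0 {V : nmodType} (F : tree -> V) : \sum_(t <- trees 0) F t = 0.
Proof. by apply: big1_seq => t /andP[_]; rewrite mem_trees. Qed.

Lemma big_trees_delta {R : nzRingType} n u (F : tree -> R) : (order u < n)%N ->
  \sum_(t <- trees n) F t * (t == u)%:R = F u.
Proof.
move=> un; rewrite (bigD1_seq u) ?trees_uniq ?mem_trees //= eqxx mulr1.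
by rewrite big1 ?addr0 // => t tu; rewrite (negbTE tu) mulr0.
Qed.

Lemma big_trees_deltal {R : nzRingType} n u (F : tree -> R) : (order u < n)%N ->
  \sum_(t <- trees n) (t == u)%:R * F t = F u.
Proof.
move=> un; rewrite -[RHS](big_trees_delta _ un); apply: eq_bigr => t _.
by rewrite mulr_natl mulr_natr.
Qed.

Lemma mu_over_coef_eq_order t u :
  order t = order u -> t != u -> mu_over_coef t u = 0.
Proof. by move=> tu tNu; rewrite mu_over_coef_small ?tu // (negbTE tNu). Qed.

Lemma mu_over_coef_diag t : mu_over_coef t t = 1.
Proof. by rewrite mu_over_coef_small // eqxx. Qed.

(** The left antipode law on [u], solved for its diagonal term. The recursion is on the order of
    trees, which is not structural, so n is fuel: when started above [order u], it never reaches the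
    default 0. *)
Fixpoint antipode_rec (n : nat) (u : tree) : HY :=
  if n is n'.+1 then
    if u == Leaf then 1
    else - \sum_(t <- trees (order u)) antipode_rec n' t * mu_over_coef t u
  else 0.

Lemma antipode_recS n u : antipode_rec n.+1 u =
  if u == Leaf then 1
  else - \sum_(t <- trees (order u)) antipode_rec n t * mu_over_coef t u.
Proof. by []. Qed.

Lemma antipode_rec_stable n k u : (order u < n)%N -> (order u < k)%N ->
  antipode_rec n u = antipode_rec k u.
Proof.
elim: n k u => [|n IH] k u; first by rewrite ltn0.
case: k => [|k] un uk; first by rewrite ltn0 in uk.
rewrite !antipode_recS; case: eqP => [//|_]; apply: congr1.
apply: eq_big_seq => t; rewrite mem_trees => tu; congr (_ * _).
by apply: IH; [exact: leq_trans tu un | exact: leq_trans tu uk].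
Qed.

HB.lock Definition antipode_tree (u : tree) : HY := antipode_rec (order u).+1 u.

Lemma antipode_tree_Leaf : antipode_tree Leaf = 1.
Proof. by rewrite antipode_tree.unlock. Qed.

Lemma antipode_treeE u : u != Leaf ->
  antipode_tree u =
  - \sum_(t <- trees (order u)) antipode_tree t * mu_over_coef t u.
Proof.
move=> u0; rewrite antipode_tree.unlock antipode_recS (negbTE u0).
apply: congr1; apply: eq_big_seq => t; rewrite mem_trees => tu; congr (_ * _).
exact: antipode_rec_stable.
Qed.

Definition antipode_map : HY -> HY :=
  free_antilift (fun u : Ybar => antipode_tree (val u)).

Local Notation S := antipode_map.

Lemma antipode_map_linear : linear S.
Proof. exact: free_antilift_linear. Qed.

Lemma antipode_map1 : S 1 = 1.
Proof. exact: free_antilift1. Qed.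

Lemma antipode_mapM a b : S (a * b) = S b * S a.
Proof. by apply: free_antiliftM => x; apply: mulr_linearr. Qed.

Lemma antipode_map_ygen u : S (ygen u) = antipode_tree u.
Proof.
rewrite /ygen; case: insubP => [v _ <-|]; first exact: free_antilift_gen.
by rewrite negbK => /eqP ->; rewrite antipode_tree_Leaf; apply: antipode_map1.
Qed.

Lemma convl_coproduct_gen u : convl S (coproduct (gen u)) = 0.
Proof.
have Tl := convl_linear S.
rewrite -ygen_val (coproduct_ygen (ltnSn _)) (linear_fun_sum Tl).
have E t : convl S (tens (ygen t) (mu_over_coef t (val u))) =
    antipode_tree t * mu_over_coef t (val u).
  by rewrite convl_tens ?antipode_map_ygen //; exact: antipode_map_linear.
rewrite (eq_bigr _ (fun t _ => E t)) big_trees_recr => [|t tu tNu].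
  rewrite mu_over_coef_diag mulr1 antipode_treeE ?addNr //.
  exact: valP u.
by rewrite (mu_over_coef_eq_order tu tNu) mulr0.
Qed.

Lemma convl_coproduct a : convl S (coproduct a) = (counit a)%:A.
Proof.
have Tl := convl_linear S; have [Dl [D1 DM]] := coproduct_morphism.
move: a; apply: free_ind => [|u a aE|k a b aE bE].
- rewrite D1 -tens1 convl_tens; last exact: antipode_map_linear.
  by rewrite antipode_map1 mulr1 counit1 scale1r.
(* In [convl] the left factor is innermost: the value 0 at the generator annihilates the product. *)
- rewrite DM (convlM antipode_map_linear antipode_mapM (k := 0)); last first.
    by rewrite convl_coproduct_gen scale0r.
  by rewrite counitM counit_gen mul0r !scale0r.
- exact: (linear_eq_comb (linear_comp Tl Dl)
    (algebra_morphism_scalel counit_morphism 1)) aE bE.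
Qed.

(* The matrix g = (S (mu_over_coef t u)) is a left inverse of the matrix
   f = (mu_over_coef t u); as f is unitriangular for the order of trees, g is
   also a right inverse, and the row of index o of f g gives the claim. *)
Lemma antipode_coefl x u n : (order u < n)%N ->
  \sum_(t <- trees n) S (mu_over_coef x t) * mu_over_coef t u = (x == u)%:R.
Proof.
move=> un; have := convl_coproduct (mu_over_coef x u).
rewrite (coproduct_mu_over_coef _ un) (linear_fun_sum (convl_linear S)).
rewrite counit_mu_over_coef scaler_nat => <-; apply: eq_bigr => t _.
by rewrite convl_tens //; exact: antipode_map_linear.
Qed.

Lemma antipode_coefr u n : (order u < n)%N ->
  \sum_(t <- trees n) ygen t * S (mu_over_coef t u) = (u == Leaf)%:R.
Proof.
have S0 : S 0 = 0 by exact: (linear_fun0 antipode_map_linear).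
(* d is the row of index o of f g, with the index list truncated at m; [dW] shows that the
   truncation does not matter. *)
have [d dE] : exists d : tree -> nat -> HY, forall u m,
    d u m = \sum_(t <- trees m) ygen t * S (mu_over_coef t u) by eexists.
have dW v m : (order v < m)%N -> d v m = d v (order v).+1.
  move=> vm; rewrite !dE; apply: big_trees_widen => // t.
  case: (ltnP (order v) (order t)) => // vt.
  by rewrite mu_over_coef_gt // S0 mulr0 eqxx.
rewrite -dE => /dW ->; have [n0] := ubnP (order u).
elim: n0 u => // n0 IH {n}u; rewrite ltnS => un.
(* Since g f is the identity, the row d times f is the row o of f, which is the row of the
   generators. *)
have : \sum_(t <- trees (order u).+1) d t (order u).+1 * mu_over_coef t u = ygen u.
  transitivity (\sum_(x <- trees (order u).+1) ygen x * (x == u)%:R).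
    under [RHS]eq_bigr => x _ do
      rewrite -(antipode_coefl x (ltnSn (order u))) mulr_sumr.
    rewrite exchange_big; apply: eq_bigr => t _; rewrite dE mulr_suml.
    by apply: eq_bigr => x _; apply/esym/mulrA.
  exact: big_trees_delta.
rewrite big_trees_recr => [|t tu tNu]; last first.
  by rewrite (mu_over_coef_eq_order tu tNu) mulr0.
rewrite mu_over_coef_diag mulr1.
(* By induction d is the unit row on smaller trees. For u other than o the remaining sum is
   therefore f(o, u) = [u], already the whole right-hand side, and d vanishes at u. *)
rewrite (eq_big_seq (fun t => (t == Leaf)%:R * mu_over_coef t u)) => [|t]; last first.
  rewrite mem_trees => tu; rewrite dW ?IH //; last exact: ltnW.
  exact: leq_trans tu un.
case: (u =P Leaf) => [->|/eqP u0].
  by rewrite big_trees0 addr0 ygen_Leaf.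
rewrite big_trees_deltal; last by case: (u) u0.
rewrite mu_over_coef_Leafl => E; apply: (addIr (ygen u)).
by rewrite add0r.
Qed.

Lemma convr_coproduct_gen u : convr S (coproduct (gen u)) = 0.
Proof.
rewrite -ygen_val (coproduct_ygen (ltnSn _)) (linear_fun_sum (convr_linear S)).
have E t : convr S (tens (ygen t) (mu_over_coef t (val u))) =
    ygen t * S (mu_over_coef t (val u)).
  by rewrite convr_tens //; exact: antipode_map_linear.
rewrite (eq_bigr _ (fun t _ => E t)) antipode_coefr //.
by rewrite (negbTE (valP u)).
Qed.

Lemma convr_coproduct a : convr S (coproduct a) = (counit a)%:A.
Proof.
have Tl := convr_linear S; have [Dl [D1 DM]] := coproduct_morphism.
move: a; apply: free_ind => [|u a aE|k a b aE bE].
- rewrite D1 -tens1 convr_tens; last exact: antipode_map_linear.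
  by rewrite antipode_map1 mulr1 counit1 scale1r.
(* In [convr] the right factor is innermost: its value is a scalar by the induction hypothesis. *)
- rewrite DM (convrM antipode_map_linear antipode_mapM _ aE).
  by rewrite convr_coproduct_gen scaler0 counitM counit_gen mul0r scale0r.
- exact: (linear_eq_comb (linear_comp Tl Dl)
    (algebra_morphism_scalel counit_morphism 1)) aE bE.
Qed.

Lemma antipode_mapP : antipode coproduct counit S.
Proof.
split; [exact: antipode_map_linear | exact: convl_coproduct|].
exact: convr_coproduct.
Qed.

(** * The grading *)

Lemma word_orderM (v w : {fmonom Ybar}) :
  word_order (mmul v w) = (word_order v + word_order w)%N.
Proof. by rewrite /word_order fmM big_cat. Qed.

Lemma word_order1 : word_order mone = 0%N.
Proof. by rewrite /word_order fm1 big_nil. Qed.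

(** Letters have positive order, because o has been identified with 1; connectedness rests on
    this. *)
Lemma word_order_eq0 (w : {fmonom Ybar}) : word_order w = 0%N -> w = mone.
Proof.
move=> w0; apply: val_inj; rewrite /= fm1; move: w0; rewrite /word_order.
case: (w : seq Ybar) => // u s; rewrite big_cons => /eqP.
by rewrite addn_eq0 => /andP[]; have := valP u; case: (val u).
Qed.

Lemma homogeneousP n (a : HY) :
  homogeneous n a <-> forall w, word_order w != n -> a@_w = 0.
Proof.
split=> [ha w|ha w]; last by apply: contraTeq => /ha wa; rewrite -mcoeff_eq0 wa.
by move=> wn; apply: mcoeff_outdom; apply: contra wn => /ha ->.
Qed.

Lemma homogeneous_linear n k a b :
  homogeneous n a -> homogeneous n b -> homogeneous n (k *: a + b).
Proof.
move=> /homogeneousP ha /homogeneousP hb; apply/homogeneousP => w wn.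
by rewrite mcoeffD mcoeffZ ha // hb // mulr0 addr0.
Qed.

Lemma homogeneous0 n : homogeneous n 0.
Proof. by apply/homogeneousP => w _; rewrite mcoeff0. Qed.

Lemma homogeneousZ n k a : homogeneous n a -> homogeneous n (k *: a).
Proof.
by move=> ha; rewrite -[k *: a]addr0; apply: homogeneous_linear => //;
  apply: homogeneous0.
Qed.

Lemma homogeneous_sum n (T : eqType) (r : seq T) (F : T -> HY) :
  (forall i, i \in r -> homogeneous n (F i)) ->
  homogeneous n (\sum_(i <- r) F i).
Proof.
move=> hF; rewrite big_seq; elim/big_rec: _ => [|i x /hF hi hx].
  exact: homogeneous0.
by rewrite -[F i]scale1r; apply: homogeneous_linear.
Qed.

Lemma homogeneousU (w : {fmonom Ybar}) : homogeneous (word_order w) << w >>.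
Proof.
apply/homogeneousP => v vw; rewrite mcoeffU1.
by case: (w =P v) vw => [->|]; rewrite ?eqxx.
Qed.

Lemma homogeneous1 : homogeneous 0 1.
Proof. by rewrite -word_order1; exact: homogeneousU. Qed.

Lemma homogeneousM m n a b :
  homogeneous m a -> homogeneous n b -> homogeneous (m + n) (a * b).
Proof.
move=> ha hb; rewrite [a]malg_basis [b]malg_basis mulr_suml.
apply: homogeneous_sum => v va; rewrite mulr_sumr.
apply: homogeneous_sum => w wb; rewrite -scalerM -malgUM.
rewrite -(ha v va) -(hb w wb) -word_orderM.
exact/homogeneousZ/homogeneousU.
Qed.

Lemma homogeneous_prod (T : eqType) (r : seq T) (F : T -> HY) (d : T -> nat) :
  (forall i, i \in r -> homogeneous (d i) (F i)) ->
  homogeneous (\sum_(i <- r) d i) (\prod_(i <- r) F i).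
Proof.
elim: r => [|i r IH] hF; first by rewrite !big_nil; exact: homogeneous1.
rewrite !big_cons; apply: homogeneousM; first exact/hF/mem_head.
by apply: IH => j jr; apply: hF; rewrite inE jr orbT.
Qed.

Lemma homogeneous_ygen t : homogeneous (order t) (ygen t).
Proof.
rewrite /ygen; case: insubP => [u _ <-|]; last first.
  by rewrite negbK => /eqP ->; exact: homogeneous1.
have <- : word_order (fmu u) = order (val u) by rewrite /word_order fmU big_seq1.
exact: homogeneousU.
Qed.

(** Each factorization satisfies |u| = |t| + |s_1| + ... + |s_(|t|+1)|. If |u| < |t| there is none,
    so the truncated subtraction is harmless. *)
Lemma homogeneous_mu_over_coef t u :
  homogeneous (order u - order t) (mu_over_coef t u).
Proof.
rewrite mu_over_coef.unlock; apply: homogeneous_sum => s.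
case: (lastP s) => [|{}s x].
  by rewrite mem_mu_over_factors.
rewrite mem_mu_over_factors_aux; last exact: mem_mu_factors.
move=> /andP[/eqP sz /eqP ->].
rewrite order_over order_mu ?size_map // big_map.
under eq_bigr do rewrite order_over addn1 -addn1.
rewrite big_split /= sum1_size sz addnAC addnK -big_rcons.
by apply: homogeneous_prod => y _; apply: homogeneous_ygen.
Qed.

Lemma homogeneous_antipode_tree u : homogeneous (order u) (antipode_tree u).
Proof.
have [n] := ubnP (order u); elim: n u => // n IH u; rewrite ltnS => un.
case: (altP (u =P Leaf)) => [->|u0].
  by rewrite antipode_tree_Leaf; exact: homogeneous1.
rewrite antipode_treeE // -scaleN1r; apply/homogeneousZ/homogeneous_sum => t.
rewrite mem_trees => tu; rewrite -(subnKC (ltnW tu)).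
apply: homogeneousM; first exact/IH/(leq_trans tu).
exact: homogeneous_mu_over_coef.
Qed.

Lemma homogeneous_antipode n a : homogeneous n a -> homogeneous n (antipode_map a).
Proof.
move=> ha; rewrite /antipode_map /free_antilift /mlift.
apply: homogeneous_sum => w wa; apply: homogeneousZ; rewrite -(ha w wa).
rewrite /word_order -(perm_big _ (permEl (perm_rev w))).
by apply: homogeneous_prod => u _; apply: homogeneous_antipode_tree.
Qed.

Lemma homogeneous_grading : algebra_grading homogeneous.
Proof.
split.
- exact: homogeneous0.
- exact: homogeneous_linear.
(* The successor makes every word order occurring in a an index strictly below N. *)
- move=> a; pose N := (\max_(w <- msupp a) word_order w).+1.
  exists N, (fun n => \sum_(w <- msupp a | word_order w == n) a@_w *: << w >>).
  split=> [n|].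
    rewrite -big_filter; apply: homogeneous_sum => w.
    rewrite mem_filter => /andP[/eqP <- _].
    exact/homogeneousZ/homogeneousU.
  rewrite (exchange_big_dep xpredT) //= {1}[a]malg_basis.
  apply: eq_big_seq => w wa.
  have wN : (word_order w < N)%N by rewrite ltnS; apply: leq_bigmax_seq.
  by rewrite (big_pred1 (Ordinal wN)) // => i; rewrite eq_sym.
- move=> N f hf f0 n nN; apply/malgP => w; rewrite mcoeff0.
  have [wn|wn] := eqVneq (word_order w) n; last first.
    by have /homogeneousP -> := hf n.
  (* At a word of order n, only the summand of index n can have a nonzero coefficient. *)
  transitivity ((\sum_(n < N) f n)@_w); last by rewrite f0 mcoeff0.
  rewrite raddf_sum (bigD1 (Ordinal nN)) //= big1 ?addr0 // => i ni.
  have /homogeneousP -> // := hf i.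
  by rewrite wn; apply: contra ni => /eqP ni; apply/eqP/val_inj.
- exact: homogeneous1.
- exact: homogeneousM.
Qed.

Lemma homogeneous_connected a : homogeneous 0 a <-> exists c : rat, a = c%:A.
Proof.
split=> [ha|[c ->]]; last exact/homogeneousZ/homogeneous1.
exists a@_mone; apply/malgP => w; rewrite mcoeffZ mcoeff1.
case: eqP => [->|w1]; first by rewrite mulr1.
rewrite mulr0; move/homogeneousP: ha => ->//.
by apply/eqP => /word_order_eq0.
Qed.

Lemma counit_homogeneous n a : homogeneous n a -> n != 0%N -> counit a = 0.
Proof.
move=> ha n0; rewrite /counit /free_lift /mlift big1_seq // => w /andP[_ wa].
have : word_order w != 0%N by rewrite (ha w wa).
rewrite /word_order; case: (w : seq _) => [|u s _]; first by rewrite !big_nil.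
by rewrite big_cons mul0r scaler0.
Qed.

Section TensGrading.
Local Notation TG := (tens_grading homogeneous).

Lemma tens_grading_tens m n a b :
  homogeneous m a -> homogeneous n b -> TG (m + n) (tens a b).
Proof.
move=> ha hb; exists [:: (a, b)]; rewrite big_seq1; split=> // p.
by rewrite inE => /eqP ->; exists m, n.
Qed.

Lemma tens_grading0 n : TG n 0.
Proof. by exists [::]; rewrite big_nil. Qed.

Lemma tens_gradingD n x y : TG n x -> TG n y -> TG n (x + y).
Proof.
move=> [s [hs ->]] [s' [hs' ->]]; exists (s ++ s'); rewrite big_cat; split=> // p.
by rewrite mem_cat => /orP[/hs|/hs'].
Qed.

Lemma tens_gradingZ n k x : TG n x -> TG n (k *: x).
Proof.
move=> [s [hs ->]]; exists [seq (k *: p.1, p.2) | p <- s].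
split=> [_ /mapP[p ps ->]|].
  have [i [j [ij h1 h2]]] := hs p ps.
  by exists i, j; split=> //; apply: homogeneousZ.
rewrite big_map scaler_sumr; apply: eq_bigr => p _.
by rewrite (linear_funZ (tens_linearl _)).
Qed.

Lemma tens_gradingM m n x y : TG m x -> TG n y -> TG (m + n) (x * y).
Proof.
move=> [s [hs ->]] [s' [hs' ->]].
exists [seq (p.1 * q.1, p.2 * q.2) | p <- s, q <- s']; split.
  move=> _ /allpairsP[[p q] /= [/hs[i [j [<- h1 h2]]] /hs'[k [l [<- h3 h4]]] ->]].
  by exists (i + k)%N, (j + l)%N; split; [rewrite addnACA|apply: homogeneousM..].
rewrite big_allpairs_dep mulr_suml; apply: eq_bigr => p _.
by rewrite mulr_sumr; apply: eq_bigr => q _; rewrite tensM.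
Qed.

Lemma tens_grading_sum n (T : eqType) (r : seq T) (F : T -> HY2) :
  (forall i, i \in r -> TG n (F i)) -> TG n (\sum_(i <- r) F i).
Proof.
move=> hF; rewrite big_seq; elim/big_rec: _ => [|i x /hF hi hx].
  exact: tens_grading0.
exact: tens_gradingD.
Qed.

Lemma coproduct_homogeneous n a : homogeneous n a -> TG n (coproduct a).
Proof.
move=> ha; rewrite /coproduct /free_lift /mlift.
apply: tens_grading_sum => w wa; apply: tens_gradingZ; rewrite -(ha w wa).
rewrite /word_order; elim: (w : seq _) => [|u s IH].
  by rewrite !big_nil -tens1; apply: (@tens_grading_tens 0 0); exact: homogeneous1.
rewrite !big_cons; apply: tens_gradingM => //.
rewrite -[coproduct_gen u]free_lift_gen -/coproduct -ygen_val.
rewrite (coproduct_ygen (ltnSn _)); apply: tens_grading_sum => t.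
rewrite mem_trees ltnS => tu; rewrite -(subnKC tu); apply: tens_grading_tens.
  exact: homogeneous_ygen.
exact: homogeneous_mu_over_coef.
Qed.

End TensGrading.

Lemma coproduct_hopf : graded_connected_hopf homogeneous coproduct counit.
Proof.
split.
- exact: coproduct_bialgebra.
- exact: homogeneous_grading.
- exact: coproduct_homogeneous.
- exact: counit_homogeneous.
- exists antipode_map; split; [exact: antipode_mapP | exact: homogeneous_antipode].
- exact: homogeneous_connected.
Qed.

(** * The quotient of the free algebra on all trees *)

Section Quotient.
Local Notation c := (gen Leaf - 1 : free_algebra tree).
Local Notation Q := (ideal_quotient c).
Local Notation F := (free_lift ygen : free_algebra tree -> HY).
Local Notation G := (free_lift (fun u : Ybar => gen (val u)) : HY -> free_algebra tree).

(** F sends both o and 1 to 1, hence kills the ideal, so the choice of representative is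
    immaterial. *)
Definition quotient_ygen (x : Q) : HY := F (repr x).

Lemma free_lift_ygen_morphism : algebra_morphism F.
Proof. by apply: free_lift_morphism => x; apply: mulr_linearr. Qed.

Lemma free_lift_val_morphism : algebra_morphism G.
Proof. by apply: free_lift_morphism => x; apply: mulr_linearr. Qed.

Lemma free_lift_ygen_ideal a : a \in ideal_gen c -> F a = 0.
Proof.
have [Fl [F1 FM]] := free_lift_ygen_morphism.
move=> /ideal_genP[s ->]; rewrite (linear_fun_sum Fl) big1 // => p _.
rewrite !FM (_ : F c = 0) ?mulr0 ?mul0r //.
by rewrite (linear_funB Fl) F1 free_lift_gen ygen_Leaf subrr.
Qed.

Lemma quotient_ygen_pi a : quotient_ygen (qpi c a) = F a.
Proof.
have [Fl _] := free_lift_ygen_morphism.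
apply: subr0_eq; apply: etrans (esym (linear_funB Fl _ _)) _.
exact/free_lift_ygen_ideal/repr_qpi.
Qed.

Lemma free_lift_valK : cancel G F.
Proof.
apply: (free_ext (f := F \o G) (g := id)) => [||u].
- exact: algebra_morphism_comp free_lift_ygen_morphism free_lift_val_morphism.
- exact: algebra_morphism_id.
- by rewrite /= free_lift_gen free_lift_gen ygen_val.
Qed.

Lemma qpi_linear : linear (qpi c).
Proof. by move=> k x y; rewrite qpiD qpiZ. Qed.

Lemma qpi_free_liftK a : qpi c (G (F a)) = qpi c a.
Proof.
have [Fl [F1 FM]] := free_lift_ygen_morphism.
have [Gl [G1 GM]] := free_lift_val_morphism.
have genE t : qpi c (G (F (gen t))) = qpi c (gen t).
  rewrite free_lift_gen /ygen.
  case: insubP => [u _ <-|]; first by rewrite free_lift_gen.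
  rewrite negbK => /eqP -> /=; rewrite G1; apply/qpiP.
  (* Up to sign, 1 - o is the generator of the ideal, written as 1 * c * 1. *)
  rewrite -opprB rpredN; apply/ideal_genP; exists [:: (1, 1)].
  by rewrite big_seq1 mul1r mulr1.
(* [Q] carries its ring and module structures separately, whereas [free_ext] asks for an algebra as
   target; the induction is therefore done directly with [qpiM]. *)
move: a; apply: free_ind => [|t a aE|k a b aE bE].
- by rewrite F1 G1.
- apply: etrans (congr1 (qpi c) (etrans (congr1 G (FM _ _)) (GM _ _))) _.
  apply: etrans (qpiM _ _ _) _; apply: etrans (congr2 _ (genE t) aE) _.
  exact/esym/qpiM.
- exact: (linear_eq_comb (f := qpi c \o (G \o F)) (g := qpi c)
    (linear_comp qpi_linear (linear_comp Gl Fl)) qpi_linear) aE bE.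
Qed.

Lemma quotient_ygen_bij : bijective quotient_ygen.
Proof.
exists (fun y => qpi c (G y)) => [x|y].
  by rewrite /quotient_ygen qpi_free_liftK qreprK.
by rewrite quotient_ygen_pi free_lift_valK.
Qed.

Lemma quotient_ygen_linear : linear quotient_ygen.
Proof.
have [Fl _] := free_lift_ygen_morphism.
move=> k x y; have -> : k *: x + y = qpi c (k *: repr x + repr y).
  by rewrite qpiD qpiZ !qreprK.
by rewrite quotient_ygen_pi Fl.
Qed.

Lemma quotient_ygen_monoid_morphism : monoid_morphism quotient_ygen.
Proof.
have [_ [F1 FM]] := free_lift_ygen_morphism.
split=> [|x y]; first by rewrite [1]/(qpi c 1) quotient_ygen_pi F1.
have -> : x * y = qpi c (repr x * repr y) by rewrite qpiM !qreprK.
by rewrite quotient_ygen_pi FM.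
Qed.

End Quotient.

Theorem corollary4p6 :
  [/\ exists phi : ideal_quotient (gen Leaf - 1 : free_algebra tree) -> HY,
        [/\ bijective phi, linear phi, monoid_morphism phi
          & forall t : tree, phi (qpi _ (gen t)) = ygen t],
      graded_connected_hopf homogeneous coproduct counit,
      forall u : Ybar, coproduct (gen u) =
        tens 1 (gen u) +
        \sum_(p \in coproduct_index (val u))
          tens (gen p.1) (\prod_(x <- p.2) ygen x)
    & forall u : Ybar, counit (gen u) = 0].
Proof.
split.
- exists quotient_ygen; split.
  + exact: quotient_ygen_bij.
  + exact: quotient_ygen_linear.
  + exact: quotient_ygen_monoid_morphism.
  + by move=> t; rewrite quotient_ygen_pi free_lift_gen.
- exact: coproduct_hopf.
- by move=> u; apply: free_lift_gen.
- exact: counit_gen.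
Qed.
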